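(* For an arbitrary MDP $\mathcal{M}$ with integer weights and designated absorbing state $\mathit{goal}$, the optimal conditional expectation $\mathit{CE}^{\sup}_{\mathcal{M},s_{\mathit{init}}}$ is finite if and only if there are no positively weight-divergent end components in $\mathcal{M}$ and no critical schedulers for $\mathcal{M}$.
   Context: A Markov decision process (MDP) is a tuple $\mathcal{M}=(S,\mathit{Act},P,s_{\mathit{init}},\mathit{wgt})$ with finite state set $S$, finite action set $\mathit{Act}$, initial state $s_{\mathit{init}}$, $P:S\times\mathit{Act}\times S\to[0,1]\cap\mathbb{Q}$ with $\sum_{t}P(s,\alpha,t)\in\{0,1\}$, and $\mathit{wgt}:S\times\mathit{Act}\to\mathbb{Z}$. $\mathit{Act}(s)$ is the (nonempty) set of actions $\alpha$ enabled in $s$, i.e. with $\sum_tP(s,\alpha,t)=1$. All states are assumed reachable from $s_{\mathit{init}}$. A state is absorbing if its only enabled action leads back to it with probability $1$ and weight $0$. A path is an alternating sequence $s_0\alpha_0s_1\alpha_1\dots$ with $P(s_i,\alpha_i,s_{i+1})>0$; for a finite path $\pi$, $\mathit{wgt}(\pi)$ is the sum of the weights of its steps. A scheduler $\mathfrak{S}$ assigns to every finite path $\pi$ a probability distribution on $\mathit{Act}(\mathit{last}(\pi))$, where $\mathit{last}(\pi)$ is the last state; $\Pr^{\mathfrak{S}}_{s}$ and $\mathbb{E}^{\mathfrak{S}}_s$ denote the induced measure on infinite paths from $s$ and its expectation. An $\mathfrak{S}$-path is a path along which every chosen action has positive probability under $\mathfrak{S}$. $\Diamond\mathit{goal}$ is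 the event of reaching $\mathit{goal}$ and $\Diamond(\mathit{wgt}\ge n)$ is the set of infinite paths having a prefix of weight at least $n$. Standing assumption: there is a designated absorbing state $\mathit{goal}$, and all states from which $\mathit{goal}$ is not reachable are collapsed to one absorbing state $\mathit{fail}$. The random variable $\oplus^0\mathit{goal}$ has as value the weight accumulated until $\mathit{goal}$ on paths reaching $\mathit{goal}$ and $0$ on all other paths. $\mathit{CE}^{\mathfrak{S}}_{\mathcal{M},s_{\mathit{init}}}=\mathbb{E}^{\mathfrak{S}}_{s_{\mathit{init}}}(\oplus^0\mathit{goal}\mid\Diamond\mathit{goal})$, defined if $\Pr^{\mathfrak{S}}_{s_{\mathit{init}}}(\Diamond\mathit{goal})>0$, and $\mathit{CE}^{\sup}_{\mathcal{M},s_{\mathit{init}}}$ is the supremum over all schedulers with $\Pr^{\mathfrak{S}}_{s_{\mathit{init}}}(\Diamond\mathit{goal})>0$. An end component is a pair $\mathcal{E}=(E,\mathfrak{A})$ with $\emptyset\ne E\subseteq S$ and $\emptyset\neq\mathfrak{A}(s)\subseteq\mathit{Act}(s)$ for $s\in E$, forming a sub-MDP (all successors under actions of $\mathfrak{A}$ stay in $E$) whose induced graph is strongly connected. It is positively weight-divergent if there is a scheduler $\mathfrak{S}$ for $\mathcal{E}$ with $\Pr^{\mathfrak{S}}_{\mathcal{E},s}(\Diamond(\mathit{wgt}\ge n))=1$ for all $s\in E$ and all $n\in\mathbb{N}$. A critical scheduler is a scheduler $\mathfrak{S}$ with $\Pr^{\mathfrak{S}}_{s_{\mathit{init}}}(\Diamond\mathit{goal})=0$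 for which there is an $\mathfrak{S}$-path from $s_{\mathit{init}}$ containing a positive cycle (a cycle of positive accumulated weight). *)

(* Defs.v *)
From HB Require Import structures.
From mathcomp Require Import all_boot all_order all_algebra.
From mathcomp Require Import all_classical all_reals all_analysis.

Set Implicit Arguments.
Unset Strict Implicit.
Unset Printing Implicit Defensive.

Import Order.TTheory GRing.Theory Num.Theory.

Local Open Scope classical_set_scope.
Local Open Scope ring_scope.

(** * Probability measures on infinite words over a finite alphabet

    The library has no extension theorem for infinite products or Markov
    chains, so the measure determined by consistent cylinder weights is built
    here from the Caratheodory extension [measure_extension]. *)

(* [t0] only serves to make the type pointed. *)
Definition stream (T : finType) (t0 : T) : Type := nat -> T.

HB.instance Definition _ (T : finType) (t0 : T) := gen_eqMixin (stream t0).
HB.instance Definition _ (T : finType) (t0 : T) := gen_choiceMixin (stream t0).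
HB.instance Definition _ (T : finType) (t0 : T) :=
  isPointed.Build (stream t0) (fun=> t0).

Fact stream_display : measure_display. Proof. exact: default_measure_display. Qed.

Definition determined (T : finType) (t0 : T) (n : nat) (A : set (stream t0)) :=
  forall w w' : stream t0, (forall i, (i < n)%N -> w i = w' i) -> A w -> A w'.

Definition cylinder (T : finType) (t0 : T) (u : seq T) : set (stream t0) :=
  [set w | mkseq w (size u) = u].
Arguments cylinder {T} t0 u.

(* The sets that are [determined n] for some n are the finite unions of
   cylinders. *)
Section cylinder_algebra.
Variables (T : finType) (t0 : T).
Implicit Types (A B : set (stream t0)) (u : seq T).

Definition clopen_cyl : set (set (stream t0)) :=
  [set A | exists n, determined n A].

Lemma determined_le m n A : (m <= n)%N -> determined m A -> determined n A.
Proof.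
by move=> mn dA w w' ww'; apply: dA => i im; apply: ww'; apply: leq_trans mn.
Qed.

Let clopen_cyl0 : clopen_cyl set0.
Proof. by exists 0%N. Qed.

Let clopen_cylU : setU_closed clopen_cyl.
Proof.
move=> A B [m dA] [n dB]; exists (maxn m n) => w w' ww' [Aw|Bw]; [left|right].
- by apply: (determined_le (leq_maxl m n) dA) Aw.
- by apply: (determined_le (leq_maxr m n) dB) Bw.
Qed.

Let clopen_cylC : setC_closed clopen_cyl.
Proof.
move=> A [n dA]; exists n => w w' ww' nAw Aw'; apply: nAw.
by apply: dA Aw' => i /ww' ->.
Qed.

HB.instance Definition _ := @isAlgebraOfSets.Build stream_display
  (stream t0) clopen_cyl clopen_cyl0 clopen_cylU clopen_cylC.

Lemma determined_cylinder u : determined (size u) (cylinder t0 u).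
Proof.
move=> w w' ww' wu; rewrite /cylinder /= -[RHS]wu.
apply: (@eq_from_nth _ t0); rewrite ?size_mkseq// => i ilt.
by rewrite !nth_mkseq// ww'.
Qed.

Lemma measurable_cylinder u :
  measurable (cylinder t0 u : set (stream t0)).
Proof. by exists (size u); exact: determined_cylinder. Qed.

Lemma clopen_cyl_compact (A : set (stream t0)) (F : (set (stream t0))^nat) :
  clopen_cyl A -> (forall k, clopen_cyl (F k)) -> A `<=` \bigcup_k F k ->
  exists N, A `<=` \bigcup_(k < N) F k.
Proof.
move=> [m dA] dF AF.
pose good u := exists N, A `&` cylinder t0 u `<=` \bigcup_(k < N) F k.
have [[N goodN]|bad0] := pselect (good [::]).
  by exists N => w Aw; apply: goodN.
have badS u : ~ good u -> exists t, ~ good (rcons u t).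
  move=> badu; apply/existsNP => goodS; apply: badu.
  have {}goodS t := cid (goodS t).
  exists (\max_t sval (goodS t)) => w [Aw wu].
  have [|k kN Fkw] := svalP (goodS (w (size u))) w.
    by split=> //; rewrite /cylinder /= size_rcons mkseqS wu.
  by exists k => //; apply: leq_trans kN (leq_bigmax _).
have next_ (u : {u | ~ good u}) : {t | ~ good (rcons (sval u) t)}.
  exact/cid/badS/(svalP u).
pose step (u : {u | ~ good u}) : {u | ~ good u} :=
  exist (fun u => ~ good u) _ (svalP (next_ u)).
pose U n := iter n step (exist (fun u => ~ good u) _ bad0).
pose w : stream t0 := fun n => sval (next_ (U n)).
have Uw n : sval (U n) = mkseq w n.
  by elim: n => // n IHn; rewrite mkseqS -IHn.
have badw n : ~ good (mkseq w n) by rewrite -Uw; exact: (svalP (U n)).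
have agree n w' : cylinder t0 (mkseq w n) w' -> forall i, (i < n)%N -> w' i = w i.
  rewrite /cylinder /= size_mkseq => eqw i ilt.
  by rewrite -(nth_mkseq t0 w' ilt) eqw nth_mkseq.
have [Aw|nAw] := pselect (A w).
  have [k _ Fkw] := AF _ Aw; have [n dFk] := dF k.
  exfalso; apply: (badw n); exists k.+1 => w' [_ w'n]; exists k => //=.
  by apply: dFk Fkw => i /(agree _ _ w'n) ->.
exfalso; apply: (badw m); exists 0%N => w' [Aw' w'm]; exfalso; apply: nAw.
by apply: dA Aw'; apply: agree.
Qed.

End cylinder_algebra.

Record prefix_weight (R : realType) (T : finType) := PrefixWeight {
  pweight :> seq T -> R;
  pweight_nil : pweight [::] = 1;
  pweight_ge0 : forall u, 0 <= pweight u;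
  pweight_rcons : forall u, \sum_(t : T) pweight (rcons u t) = pweight u }.

Section stream_measure.
Variables (R : realType) (T : finType) (t0 : T) (p : prefix_weight R T).
Implicit Types (A : set (stream t0)) (u : seq T).

Fixpoint words (n : nat) : seq (seq T) :=
  if n is n'.+1 then [seq rcons u t | u <- words n', t <- enum T] else [:: [::]].

Definition extend u : stream t0 := nth t0 u.

Definition word_mass (n : nat) A : R := \sum_(u <- words n) p u * \1_A (extend u).

(* The sequence is eventually constant on finite unions of cylinders. *)
Definition stream_content A : \bar R := limn (fun n => (word_mass n A)%:E).

Lemma size_words n u : u \in words n -> size u = n.
Proof.
elim: n u => [|n IHn] u; first by rewrite inE => /eqP ->.
by move=> /allpairsP[[v t] [/= vn _ ->]]; rewrite size_rcons IHn.
Qed.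

Lemma mem_words u : u \in words (size u).
Proof.
elim/last_ind: u => [|u t IHu]; first by rewrite inE.
by rewrite size_rcons /=; apply/allpairsP; exists (u, t); rewrite mem_enum.
Qed.

Lemma uniq_words n : uniq (words n).
Proof.
elim: n => //= n IHn; apply: allpairs_uniq => //; first exact: enum_uniq.
by move=> [u t] [v t'] _ _ /= /rcons_inj[-> ->].
Qed.

Lemma word_massS n A : determined n A -> word_mass n.+1 A = word_mass n A.
Proof.
move=> dA; rewrite /word_mass /= big_allpairs_dep /=.
apply: eq_big_seq => u /size_words un.
transitivity (\sum_(t <- enum T) p (rcons u t) * \1_A (extend u)); last first.
  by rewrite -mulr_suml big_enum /= pweight_rcons.
apply: eq_bigr => t _; congr (_ * _); rewrite !indicE; congr (_%:R).
congr nat_of_bool; apply/idP/idP; rewrite !inE; apply: dA => i ilt;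
  by rewrite /extend nth_rcons un ilt.
Qed.

Lemma word_mass_determined m n A :
  (m <= n)%N -> determined m A -> word_mass n A = word_mass m A.
Proof.
move=> /subnK <-; elim: (n - m)%N => [//|k IHk] dA.
by rewrite addSn word_massS ?IHk//; apply: determined_le dA; rewrite leq_addl.
Qed.

Lemma stream_contentE n A : determined n A -> stream_content A = (word_mass n A)%:E.
Proof.
move=> dA; apply: lim_near_cst => //.
by exists n => // k /= nk; rewrite (word_mass_determined nk dA).
Qed.

Lemma word_mass_ge0 n A : 0 <= word_mass n A.
Proof. by apply: sumr_ge0 => u _; rewrite mulr_ge0// pweight_ge0. Qed.

Let stream_content_ge0 A : (0 <= stream_content A)%E.
Proof.
have [cA|ncA] := pselect (cvgn (fun n => (word_mass n A)%:E)).
  by apply: lime_ge => //; apply: nearW => n; rewrite lee_fin word_mass_ge0.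
by rewrite /stream_content (dvgP ncA).
Qed.

Let stream_content_additive : measure_function.semi_additive stream_content.
Proof.
apply/additive2P.
  by rewrite (@stream_contentE 0%N)// /word_mass big1// => u _; rewrite indic0 mulr0.
move=> A B [m dA] [n dB] AB0.
have {}dA := determined_le (leq_maxl m n) dA.
have {}dB := determined_le (leq_maxr m n) dB.
have dAB : determined (maxn m n) (A `|` B).
  by move=> w w' ww' [/(dA _ _ ww')|/(dB _ _ ww')]; [left|right].
rewrite (stream_contentE dA) (stream_contentE dB) (stream_contentE dAB) -EFinD.
congr (_%:E); rewrite /word_mass -big_split /=; apply: eq_bigr => u _.
rewrite -mulrDr; congr (_ * _); rewrite !indicE in_setU -natrD; congr (_%:R).
have : ~ (A `&` B) (extend u) by rewrite AB0.
case: (asboolP (A (extend u))) => Au; case: (asboolP (B (extend u))) => Bu => nAB;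
  rewrite ?(mem_set Au) ?(memNset Au) ?(mem_set Bu) ?(memNset Bu)//.
by case: nAB.
Qed.

HB.instance Definition _ := isContent.Build _ _ _ stream_content
  stream_content_ge0 stream_content_additive.

Let stream_content_sigma_subadditive :
  measurable_subset_sigma_subadditive stream_content.
Proof.
move=> A F mF mA AF.
have [N AN] := clopen_cyl_compact mA mF AF.
apply: (@le_trans _ _ (\sum_(k < N) stream_content (F k))%E).
  by apply: content_subadditive => //; rewrite -bigcup_mkord.
rewrite -(big_mkord xpredT (stream_content \o F)).
by apply: nneseries_lim_ge => k _ _ /=.
Qed.

HB.instance Definition _ := Content_SigmaSubAdditive_isMeasure.Build _ _ _
  stream_content stream_content_sigma_subadditive.

Definition stream_measure := measure_extension stream_content.
HB.instance Definition _ := Measure.on stream_measure.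

Lemma stream_measure_cylinder u : stream_measure (cylinder t0 u) = (p u)%:E.
Proof.
rewrite /stream_measure /measure_extension measurable_mu_extE /=; last first.
  exact: measurable_cylinder.
rewrite (stream_contentE (@determined_cylinder _ t0 u)); congr (_%:E).
rewrite /word_mass (bigD1_seq u) ?mem_words ?uniq_words//=.
rewrite big_seq_cond big1 => [|v /andP[/size_words vu vDu]].
  rewrite addr0 indicE mem_set ?mulr1// /cylinder /extend /=.
  exact: mkseq_nth.
rewrite indicE memNset ?mulr0// /cylinder /extend /= -vu mkseq_nth.
exact/eqP.
Qed.

Let stream_measure_setT : stream_measure setT = 1%E.
Proof.
have <- : cylinder t0 [::] = setT by apply/seteqP; split.
by rewrite stream_measure_cylinder pweight_nil.
Qed.

HB.instance Definition _ := Measure_isProbability.Build _ _ _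
  stream_measure stream_measure_setT.

End stream_measure.

Arguments stream_measure {R T} t0 p.

(** * Markov decision processes *)

Record mdp := Mdp {
  state : finType;
  action : finType;
  trans : state -> action -> state -> rat;
  s_init : state;
  wgt : state -> action -> int;
  trans01 : forall s a t, 0 <= trans s a t <= 1;
  trans_sum : forall s a, \sum_t trans s a t \in [:: 0; 1];
  enabled_ex : forall s, exists a, \sum_t trans s a t == 1 }.

Section mdp_definitions.
Variable M : mdp.
Implicit Types (s t : state M) (a : action M).

Definition enabled s a : bool := \sum_t trans s a t == 1.

Definition mdp_edge : rel (state M) :=
  fun s t => [exists a, enabled s a && (0 < trans s a t)].

Definition reachable s t : bool := connect mdp_edge s t.

Definition absorbing s : Prop :=
  exists a, [/\ enabled s a, forall b, enabled s b -> b = a,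
                trans s a s = 1 & wgt s a = 0].

Definition letter : finType := (state M * action M)%type.

(* A finite path s_0 a_0 ... s_(n-1) a_(n-1) s_n is encoded as the sequence
   [:: (s_0, a_0); ...; (s_(n-1), a_(n-1))] together with its last state s_n. *)
Definition first_state (h : seq letter) s : state M := head s (unzip1 h).

Fixpoint is_path (h : seq letter) s : bool :=
  if h is (s0, a) :: h' then (0 < trans s0 a (first_state h' s)) && is_path h' s
  else true.

Definition path_wgt (h : seq letter) : int := \sum_(x <- h) wgt x.1 x.2.

(* The segment [c] of the path [(h1 ++ c ++ h2, s)] is a cycle if its first
   state equals the state that follows it. *)
Definition has_positive_cycle (h : seq letter) s : Prop :=
  exists h1 c h2, [/\ h = h1 ++ c ++ h2, c <> [::],
    first_state (c ++ h2) s = first_state h2 s & 0 < path_wgt c].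

(* An infinite path s_0 a_0 s_1 a_1 ... is a function nat -> letter.  All
   sequences of letters are admitted: those using a transition of probability
   0 form a null set for the measures below. *)
Definition default_letter : letter := (s_init M, xchoose (enabled_ex (s_init M))).

Definition infpath := g_sigma_algebraType
  (@measurable stream_display (stream default_letter)).

Definition prefix_wgt (w : infpath) (n : nat) : int :=
  \sum_(i < n) wgt (w i).1 (w i).2.

Definition visits (goal : state M) (w : infpath) (n : nat) : bool :=
  (w n).1 == goal.

Definition ev_reach (goal : state M) : set infpath :=
  [set w | exists n, visits goal w n].

Definition ev_wgt_ge (n : nat) : set infpath :=
  [set w | exists k, n%:Z <= prefix_wgt w k].

Definition goal_wgt (goal : state M) (w : infpath) : int :=
  if pselect (exists n, visits goal w n) is left hit
  then prefix_wgt w (ex_minn hit) else 0.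

Record end_component (E : {set state M}) (A : state M -> {set action M}) : Prop :=
  EndComponent {
    ec_nonempty : E != finset.set0;
    ec_actions : forall s, s \in E -> A s != finset.set0;
    ec_enabled : forall s a, s \in E -> a \in A s -> enabled s a;
    ec_closed : forall s a t, s \in E -> a \in A s -> 0 < trans s a t -> t \in E;
    ec_connected : forall s t, s \in E -> t \in E ->
      connect [rel x y | (x \in E) && [exists a in A x, 0 < trans x a y]] s t }.

End mdp_definitions.

Section schedulers.
Variables (R : realType) (M : mdp).
Implicit Types (s t : state M) (a : action M) (h : seq (letter M)).

(* [S h s] is the distribution chosen after the finite path [(h, s)].  A choice
   is also recorded at the pairs [(h, s)] that are not paths; it is immaterial. *)
Record scheduler := Scheduler {
  choice_prob :> seq (letter M) -> state M -> action M -> R;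
  choice_ge0 : forall h s a, 0 <= choice_prob h s a;
  choice_sum : forall h s, \sum_a choice_prob h s a = 1;
  choice_enabled : forall h s a, 0 < choice_prob h s a -> enabled s a }.

Implicit Type S : scheduler.

Definition sched_path S h s : Prop :=
  is_path h s /\
  forall h1 s' a h2, h = h1 ++ (s', a) :: h2 -> 0 < S h1 s' a.

(* Probability of continuing [past] by the letters of [h], when the state
   following [past] has distribution [d]. *)
Fixpoint cont_prob S (past : seq (letter M)) (d : state M -> R) h : R :=
  if h is (s, a) :: h'
  then d s * S past s a *
       cont_prob S (rcons past (s, a)) (fun t => ratr (trans s a t)) h'
  else 1.

Definition prefix_prob S s0 h : R :=
  cont_prob S [::] (fun s => (s == s0)%:R) h.

Lemma ratr_trans_ge0 s a t : 0 <= ratr (trans s a t) :> R.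
Proof. by rewrite ler0q; case/andP: (trans01 s a t). Qed.

Lemma cont_prob_ge0 S past d h : (forall s, 0 <= d s) -> 0 <= cont_prob S past d h.
Proof.
elim: h past d => [|[s a] h IHh] past d d0 //=.
rewrite !mulr_ge0 ?choice_ge0//; apply: IHh => t; exact: ratr_trans_ge0.
Qed.

Lemma cont_prob_rcons S past d h : \sum_s d s = 1 ->
  \sum_x cont_prob S past d (rcons h x) = cont_prob S past d h.
Proof.
elim: h past d => [|[s a] h IHh] past d d1 /=.
  transitivity (\sum_s \sum_a d s * S past s a).
    by rewrite pair_big /=; apply: eq_bigr => -[s a] _; rewrite /= mulr1.
  rewrite -d1; apply: eq_bigr => s _.
  by rewrite -mulr_sumr choice_sum mulr1.
rewrite -mulr_sumr; have := choice_ge0 S past s a.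
rewrite le_eqVlt => /predU1P[<-|/choice_enabled /eqP sa1].
  by rewrite mulr0 !mul0r.
by rewrite IHh// -rmorph_sum /= sa1 rmorph1.
Qed.

Definition path_weight S s0 : prefix_weight R (letter M).
Proof.
apply: (@PrefixWeight R _ (prefix_prob S s0)) => // [u|u].
  by apply: cont_prob_ge0 => s; rewrite ler0n.
apply: cont_prob_rcons; rewrite (bigD1 s0)//= eqxx big1 ?addr0// => s.
by move=> /negPf ->.
Defined.

Definition Pr S s0 : probability (infpath M) R :=
  stream_measure (default_letter M) (path_weight S s0).

Lemma Pr_cylinder S s0 h :
  Pr S s0 (cylinder (default_letter M) h) = (prefix_prob S s0 h)%:E.
Proof. exact: stream_measure_cylinder. Qed.

Definition CE S (goal : state M) : \bar R :=
  let P := Pr S (s_init M) in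
  ((\int[P]_(w in ev_reach goal) ((goal_wgt goal w)%:~R)%:E) *
   ((fine (P (ev_reach goal)))^-1)%:E)%E.

Definition CE_sup (goal : state M) : \bar R :=
  ereal_sup [set CE S goal |
    S in [set S | (0 < Pr S (s_init M) (ev_reach goal))%E]].

(* A scheduler for the sub-MDP (E, A): on paths ending in E it only uses
   actions of A.  Started in E, it never leaves E, so that the measure it
   induces in the sub-MDP is the one it induces in M. *)
Definition scheduler_in (E : {set state M}) (A : state M -> {set action M}) S :=
  forall h s a, s \in E -> 0 < S h s a -> a \in A s.

Definition pos_wgt_divergent (E : {set state M}) (A : state M -> {set action M}) :=
  exists2 S, scheduler_in E A S &
    forall s, s \in E -> forall n : nat, Pr S s (ev_wgt_ge n) = 1%E.

Definition critical (goal : state M) S : Prop :=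
  Pr S (s_init M) (ev_reach goal) = 0%E /\
  exists h s, [/\ sched_path S h s, first_state h s = s_init M &
                  has_positive_cycle h s].

End schedulers.

(* All states are reachable from the initial one, [goal] is absorbing, and at
   most one state, which is then absorbing, cannot reach [goal]. *)
Record standing_assumptions (M : mdp) (goal : state M) : Prop :=
  StandingAssumptions {
    all_reachable : forall s, reachable (s_init M) s;
    goal_absorbing : absorbing goal;
    fail_unique : forall s t, ~~ reachable s goal -> ~~ reachable t goal -> s = t;
    fail_absorbing : forall s, ~~ reachable s goal -> absorbing s }.

(* Main.v *)
Require Import Defs.
From mathcomp Require Import all_boot all_order all_algebra.
From mathcomp Require Import all_classical all_reals all_analysis.
From mathcomp Require Import measurable_realfun zify lra.

(* Since [goal] is absorbing, conditional expectations are limits of expectations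
   over finite horizons, so everything reduces to finite-horizon bounds.

   If there is a positively weight-divergent end component, follow its scheduler
   until weight [N] has been accumulated and then explore uniformly: the negative
   part of the weight at [goal] stays bounded while the positive part grows with
   [N].  A critical scheduler only visits states from which [goal] can be avoided;
   pumping its positive cycle and avoiding [goal] whenever the cycle is left makes
   the condition select arbitrarily heavy paths.

   Conversely, call a state sure if, for every [N], the maximal probability of
   gaining weight [N] is 1.  Bounded weight increments make the maximal probability
   of gaining [j * (L + W)] at most the [j]-th power of that of gaining [L], up to a
   maximum over states; so if no state is sure, gains have geometric tails and a
   uniformly bounded expected positive part.  If some state is sure, then the sure
   states form a sub-MDP that is itself sure, in which repeated attempts, each
   succeeding with probability at least 1/2, reach every weight almost surely; its
   bottom components are positively weight-divergent.  Finally, as long as [goal]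
   is certainly avoidable the absence of critical schedulers bounds the weight, and
   the first risky action leads to [goal] with probability bounded from below; hence
   the expected positive weight at [goal] is at most a constant times the probability
   of reaching [goal]. *)

Set Implicit Arguments.
Unset Strict Implicit.
Unset Printing Implicit Defensive.

Import Order.TTheory GRing.Theory Num.Theory.

Local Open Scope classical_set_scope.
Local Open Scope ring_scope.

(** * Finite-horizon expectations *)

Section path_expectation.
Variables (R : realType) (M : mdp).
Implicit Types (S : scheduler R M) (h : seq (letter M)) (s t : state M).
Implicit Types (a : action M) (F G : seq (letter M) -> state M -> R).

Definition tprob s a t : R := ratr (trans s a t).

Lemma tprob_ge0 s a t : 0 <= tprob s a t.
Proof. exact: ratr_trans_ge0. Qed.

Lemma tprob_gt0 s a t : (0 < tprob s a t) = (0 < trans s a t).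
Proof. by rewrite /tprob ltr0q. Qed.

Lemma tprob_sum s a : enabled s a -> \sum_t tprob s a t = 1.
Proof. by rewrite -rmorph_sum => /eqP ->; rewrite rmorph1. Qed.

Lemma trans_enabled s a t : 0 < trans s a t -> enabled s a.
Proof.
move=> st; have := trans_sum s a; rewrite !inE => /orP[|//].
rewrite psumr_eq0 => [/allP/(_ t)|t' _]; last by case/andP: (trans01 s a t').
by rewrite mem_index_enum gt_eqF// => /(_ isT).
Qed.

(* Expectation of [F] at the finite path reached [n] steps after [(h, s)]. *)
Fixpoint pexp S h s n F : R :=
  if n is n'.+1 then
    \sum_a S h s a * \sum_t tprob s a t * pexp S (rcons h (s, a)) t n' F
  else F h s.

Lemma pexpS S h s n F : pexp S h s n.+1 F =
  \sum_a S h s a * \sum_t tprob s a t * pexp S (rcons h (s, a)) t n F.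
Proof. by []. Qed.

Lemma pexp_cat S h s m n F :
  pexp S h s (m + n) F = pexp S h s m (fun h' s' => pexp S h' s' n F).
Proof.
elim: m h s => //= m IHm h s.
by apply: eq_bigr => a _; congr (_ * _); apply: eq_bigr => t _; rewrite IHm.
Qed.

(** Branches of probability 0 contribute nothing, so [F] and [G] need comparing only at extensions
    of length [n] that satisfy an invariant kept by all steps of positive probability. *)
Lemma pexp_le_supp (Inv : seq (letter M) -> state M -> Prop) S h s n F G :
  (forall h s a t, Inv h s -> 0 < S h s a -> 0 < trans s a t ->
     Inv (rcons h (s, a)) t) ->
  (forall u s', size u = n -> Inv (h ++ u) s' -> F (h ++ u) s' <= G (h ++ u) s') ->
  Inv h s -> pexp S h s n F <= pexp S h s n G.
Proof.
move=> IS; elim: n h s => [|n IHn] h s FG I /=.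
  by rewrite -[h]cats0 FG// cats0.
apply: ler_sum => a _; have := choice_ge0 S h s a.
rewrite le_eqVlt => /predU1P[<-|Sa]; first by rewrite !mul0r.
rewrite ler_pM2l//; apply: ler_sum => t _; have := tprob_ge0 s a t.
rewrite le_eqVlt => /predU1P[<-|st]; first by rewrite !mul0r.
rewrite ler_pM2l// IHn//; last by apply: IS => //; rewrite -tprob_gt0.
by move=> u s' un; rewrite cat_rcons; apply: FG; rewrite /= un.
Qed.

Lemma pexp_le_inv (Inv : seq (letter M) -> state M -> Prop) S h s n F G :
  (forall h s a t, Inv h s -> 0 < S h s a -> 0 < trans s a t ->
     Inv (rcons h (s, a)) t) ->
  (forall h s, Inv h s -> F h s <= G h s) ->
  Inv h s -> pexp S h s n F <= pexp S h s n G.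
Proof. by move=> IS FG; apply: pexp_le_supp => // u s' _; exact: FG. Qed.

Lemma pexp_eq_inv (Inv : seq (letter M) -> state M -> Prop) S h s n F G :
  (forall h s a t, Inv h s -> 0 < S h s a -> 0 < trans s a t ->
     Inv (rcons h (s, a)) t) ->
  (forall h s, Inv h s -> F h s = G h s) ->
  Inv h s -> pexp S h s n F = pexp S h s n G.
Proof.
move=> IS FG I; apply/eqP; rewrite eq_le; apply/andP.
by split; apply: (@pexp_le_inv Inv) => // h' s' /FG ->.
Qed.

Lemma pexp_le S h s n F G : (forall h' s', F h' s' <= G h' s') ->
  pexp S h s n F <= pexp S h s n G.
Proof. by move=> FG; apply: (@pexp_le_inv (fun _ _ => True)). Qed.

Lemma eq_pexp S h s n F G : (forall h' s', F h' s' = G h' s') ->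
  pexp S h s n F = pexp S h s n G.
Proof. by move=> FG; apply: (@pexp_eq_inv (fun _ _ => True)). Qed.

Lemma pexp_le_cat S h s n F G :
  (forall u s', size u = n -> F (h ++ u) s' <= G (h ++ u) s') ->
  pexp S h s n F <= pexp S h s n G.
Proof.
by move=> FG; apply: (@pexp_le_supp (fun _ _ => True)) => // u s' /FG.
Qed.

(** Disabled actions, whose transition probabilities may sum to 0, are never chosen. *)
Lemma step_sum S h s c : \sum_a S h s a * \sum_t tprob s a t * c = c.
Proof.
rewrite -[RHS]mul1r -(choice_sum S h s) mulr_suml; apply: eq_bigr => a _.
have := choice_ge0 S h s a.
rewrite le_eqVlt => /predU1P[<-|/choice_enabled sa]; first by rewrite !mul0r.
by rewrite -mulr_suml tprob_sum// mul1r.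
Qed.

Lemma pexp_cst S h s n c : pexp S h s n (fun _ _ => c) = c.
Proof.
elim: n h s => //= n IHn h s; rewrite -[RHS](step_sum S h s).
by apply: eq_bigr => a _; congr (_ * _); apply: eq_bigr => t _; rewrite IHn.
Qed.

Lemma pexpD S h s n F G :
  pexp S h s n (fun h' s' => F h' s' + G h' s') = pexp S h s n F + pexp S h s n G.
Proof.
elim: n h s => //= n IHn h s; rewrite -big_split /=; apply: eq_bigr => a _.
rewrite -mulrDr -big_split /=; congr (_ * _); apply: eq_bigr => t _.
by rewrite IHn mulrDr.
Qed.

Lemma pexpZ S h s n c F :
  pexp S h s n (fun h' s' => c * F h' s') = c * pexp S h s n F.
Proof.
elim: n h s => //= n IHn h s; rewrite mulr_sumr; apply: eq_bigr => a _.
rewrite mulrCA; congr (_ * _); rewrite mulr_sumr; apply: eq_bigr => t _.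
by rewrite IHn mulrCA.
Qed.

Lemma pexpN S h s n F :
  pexp S h s n (fun h' s' => - F h' s') = - pexp S h s n F.
Proof. by rewrite -mulN1r -pexpZ; apply: eq_pexp => *; rewrite mulN1r. Qed.

Lemma pexp_sum (I : Type) (r : seq I) (F : I -> seq (letter M) -> state M -> R)
    S h s n :
  pexp S h s n (fun h' s' => \sum_(i <- r) F i h' s') =
  \sum_(i <- r) pexp S h s n (F i).
Proof.
elim: r => [|i r IHr].
  rewrite big_nil -[RHS](pexp_cst S h s n); apply: eq_pexp => *.
  by rewrite big_nil.
by rewrite big_cons -IHr -pexpD; apply: eq_pexp => *; rewrite big_cons.
Qed.

Lemma pexp_ge0 S h s n F : (forall h' s', 0 <= F h' s') -> 0 <= pexp S h s n F.
Proof. by move=> F0; rewrite -(pexp_cst S h s n 0); exact: pexp_le. Qed.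

Let wordsS n : words (letter M) n.+1 =
  [seq rcons u x | u <- words (letter M) n, x <- enum (letter M)].
Proof. by []. Qed.

Lemma sum_wordsS n (g : seq (letter M) -> R) :
  \sum_(u <- words (letter M) n.+1) g u =
  \sum_x \sum_(u <- words (letter M) n) g (x :: u).
Proof.
elim: n g => [|n IHn] g.
  rewrite wordsS big_allpairs_dep big_seq1 big_enum.
  by apply: eq_bigr => x _; rewrite big_seq1.
transitivity (\sum_(u <- words (letter M) n.+1) \sum_x g (rcons u x)).
  rewrite wordsS big_allpairs_dep; apply: eq_bigr => u _.
  by rewrite big_enum.
rewrite IHn; apply: eq_bigr => x _.
rewrite wordsS big_allpairs_dep; apply: eq_bigr => u _.
by rewrite big_enum.
Qed.

(** This links cylinder weights to the recursive expectation. It is stated for an arbitrary initial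
    distribution [d] because [cont_prob] recurses through the transition distributions. *)
Lemma words_cont_prob S past (d : state M -> R) n (g : seq (letter M) -> R) :
  \sum_s d s = 1 ->
  \sum_(u <- words (letter M) n) cont_prob S past d u * g (past ++ u) =
  \sum_s d s * pexp S past s n (fun h _ => g h).
Proof.
elim: n past d => [|n IHn] past d d1.
  by rewrite big_seq1 /= mul1r cats0 -mulr_suml d1 mul1r.
rewrite sum_wordsS /=.
transitivity (\sum_s \sum_a
    \sum_(u <- words (letter M) n) cont_prob S past d ((s, a) :: u) *
      g (past ++ (s, a) :: u)).
  by rewrite pair_big /=; apply: eq_bigr => -[].
apply: eq_bigr => s _; rewrite mulr_sumr; apply: eq_bigr => a _ /=.
have := choice_ge0 S past s a.
rewrite le_eqVlt => /predU1P[<-|/choice_enabled sa].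
  by rewrite mulr0 !mul0r big1 ?mulr0// => u _; rewrite !mul0r.
rewrite mulrA -(IHn _ _ (tprob_sum sa)) mulr_sumr; apply: eq_bigr => u _.
by rewrite mulrA cat_rcons.
Qed.

Lemma words_prefix_prob S s n (g : seq (letter M) -> R) :
  \sum_(u <- words (letter M) n) prefix_prob S s u * g u =
  pexp S [::] s n (fun h _ => g h).
Proof.
rewrite [LHS](@words_cont_prob S [::]); last first.
  by rewrite (bigD1 s)//= eqxx big1 ?addr0// => t /negPf ->.
rewrite (bigD1 s)//= eqxx mul1r big1 ?addr0// => t /negPf ->.
by rewrite mul0r.
Qed.

Let ext : seq (letter M) -> infpath M := extend (default_letter M).

(** A function of the first [n] letters is a finite combination of indicators of cylinders, which
    makes its measurability and its integral explicit. *)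
Lemma determined_cylinder_sum n (g : infpath M -> R) :
  (forall w, g w = g (ext (mkseq w n))) ->
  forall w, g w = \sum_(u <- words (letter M) n)
    g (ext u) * \1_(cylinder (default_letter M) u) w.
Proof.
move=> gn w; rewrite (bigD1_seq (mkseq w n)) ?uniq_words//=; last first.
  by rewrite -[X in words _ X](size_mkseq w n) mem_words.
rewrite big_seq_cond big1 ?addr0 => [|u /andP[/size_words un uw]]; last first.
  rewrite indicE memNset ?mulr0// /cylinder /= un => wu.
  by rewrite wu eqxx in uw.
by rewrite indicE mem_set ?mulr1// /cylinder /= size_mkseq.
Qed.

Lemma measurable_cyl u :
  measurable (cylinder (default_letter M) u : set (infpath M)).
Proof. by apply: sub_sigma_algebra; exact: measurable_cylinder. Qed.

Lemma measurable_determined n (g : infpath M -> R) :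
  (forall w, g w = g (ext (mkseq w n))) -> measurable_fun setT g.
Proof.
move=> gn; rewrite (funext (determined_cylinder_sum gn)).
apply: measurable_sum => u; apply: measurable_funM => //.
by apply: measurable_indic; exact: measurable_cyl.
Qed.

Lemma integral_determined S s n (g : infpath M -> R) :
  (forall w, 0 <= g w) -> (forall w, g w = g (ext (mkseq w n))) ->
  (\int[Pr S s]_w (g w)%:E = (pexp S [::] s n (fun h _ => g (ext h)))%:E)%E.
Proof.
move=> g0 gn; rewrite -words_prefix_prob.
under eq_integral do rewrite (determined_cylinder_sum gn) -sumEFin.
have mcyl u : measurable_fun setT
    (EFin \o (\1_(cylinder (default_letter M) u) : infpath M -> R)).
  by apply/measurable_EFinP; apply: measurable_indic; exact: measurable_cyl.
rewrite ge0_integral_sum//; last 2 first.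
- move=> u; apply/measurable_EFinP; apply: measurable_funM => //.
  by apply: measurable_indic; exact: measurable_cyl.
- by move=> u w _; rewrite lee_fin mulr_ge0.
rewrite -sumEFin; apply: eq_bigr => u _.
under eq_integral do rewrite EFinM.
rewrite ge0_integralZl_EFin//; last exact: mcyl.
rewrite integral_indic ?setIT//; last exact: measurable_cyl.
by rewrite [X in (_ * X)%E](Pr_cylinder S s u) -EFinM mulrC.
Qed.

(** Monotone convergence, with approximants [g n] that depend only on the first [l n] letters. *)
Lemma cvg_integral_determined S s (f : infpath M -> R) (g : nat -> infpath M -> R)
    (l : nat -> nat) :
  (forall n w, 0 <= g n w) -> (forall n w, g n w = g n (ext (mkseq w (l n)))) ->
  (forall w, {homo g^~ w : m n / (m <= n)%N >-> m <= n}) ->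
  (forall w, \forall n \near \oo, g n w = f w) ->
  ((pexp S [::] s (l n) (fun h _ => g n (ext h)))%:E @[n --> \oo] -->
    \int[Pr S s]_w (f w)%:E)%E.
Proof.
move=> g0 gl ndg gf.
have mg n : measurable_fun setT (EFin \o g n).
  by apply/measurable_EFinP; exact: measurable_determined (gl n).
have -> : (\int[Pr S s]_w (f w)%:E =
    \int[Pr S s]_w limn (fun n => (g n w)%:E))%E.
  apply: eq_integral => w _; apply/esym/lim_near_cst => //.
  by apply: filterS (gf w) => n ->.
under eq_fun do rewrite -integral_determined//.
apply: (@cvg_monotone_convergence _ _ _ _ _ _ (fun n w => (g n w)%:E)) => //.
- by move=> n w _; rewrite lee_fin.
- by move=> w _ m n mn; rewrite lee_fin ndg.
Qed.

End path_expectation.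

(** * Weight accumulated until the goal *)

Section reaching_goal.
Variables (R : realType) (M : mdp) (goal : state M).
Hypothesis goal_abs : absorbing goal.
Implicit Types (S : scheduler R M) (h : seq (letter M)) (s t : state M).
Implicit Types (a : action M) (phi : int -> R).

Lemma absorbing_step s a t :
  absorbing s -> 0 < trans s a t -> t = s /\ wgt s a = 0.
Proof.
move=> [b [_ only_b sbs wb]] st; have sa := trans_enabled st.
have ab := only_b _ sa; subst a; split => //; apply/eqP/negPn/negP => ts.
move: sa; rewrite /enabled (bigD1 s)//= (bigD1 t)//= sbs => /eqP.
have : 0 <= \sum_(i | (i != s) && (i != t)) trans s b i.
  by apply: sumr_ge0 => i _; case/andP: (trans01 s b i).
lra.
Qed.

Lemma path_wgt_rcons h x : path_wgt (rcons h x) = path_wgt h + wgt x.1 x.2.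
Proof. by rewrite /path_wgt big_rcons /= addrC. Qed.

Lemma path_wgt_cat h h' : path_wgt (h ++ h') = path_wgt h + path_wgt h'.
Proof. by rewrite /path_wgt big_cat. Qed.

Lemma path_wgt_cons x h : path_wgt (x :: h) = wgt x.1 x.2 + path_wgt h.
Proof. by rewrite /path_wgt big_cons. Qed.

Lemma path_wgt_nil : path_wgt (Nil (letter M)) = 0.
Proof. by rewrite /path_wgt big_nil. Qed.

Lemma prefix_wgt_mkseq (w : infpath M) n : prefix_wgt w n = path_wgt (mkseq w n).
Proof. by rewrite /path_wgt big_map -[n in iota 0 n]subn0 big_mkord. Qed.

Lemma mkseq_extend h n : (n <= size h)%N ->
  mkseq (extend (default_letter M) h) n = take n h.
Proof.
move=> nh; apply: (@eq_from_nth _ (default_letter M)).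
  by rewrite size_mkseq size_takel.
by move=> i; rewrite size_mkseq => ilt; rewrite nth_mkseq// nth_take.
Qed.

Lemma goal_wgtE (w : infpath M) n : visits goal w n ->
  (forall m, (m < n)%N -> ~~ visits goal w m) -> goal_wgt goal w = prefix_wgt w n.
Proof.
move=> wn first_n; rewrite /goal_wgt; case: pselect => [hit|[]]; last by exists n.
case: ex_minnP => m wm minm; congr prefix_wgt; apply/eqP.
by rewrite eqn_leq minm// leqNgt; apply/negP => /first_n; rewrite wm.
Qed.

Definition hits n (w : infpath M) : bool := [exists i : 'I_n.+1, visits goal w i].

Lemma hits_first n w : hits n w -> exists m, [/\ (m <= n)%N, visits goal w m &
  forall k, (k < m)%N -> ~~ visits goal w k].
Proof.
move=> /existsP[i wi]; have hit : exists i, visits goal w i by exists i.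
case: (ex_minnP hit) => m wm minm; exists m; split=> //.
  by apply: leq_trans (minm _ wi) _; rewrite -ltnS.
by move=> k km; apply/negP => /minm; rewrite leqNgt km.
Qed.

Lemma hits_mono m n w : (m <= n)%N -> hits m w -> hits n w.
Proof.
move=> mn /existsP[i wi]; apply/existsP.
by exists (widen_ord (n:=m.+1) (m:=n.+1) mn i).
Qed.

Lemma hits_extend n (w : infpath M) :
  hits n w = hits n (extend (default_letter M) (mkseq w n.+1)).
Proof.
by apply: eq_existsb => i; rewrite /visits /extend nth_mkseq.
Qed.

Lemma goal_wgt_extend n (w : infpath M) : hits n w ->
  goal_wgt goal w = goal_wgt goal (extend (default_letter M) (mkseq w n.+1)).
Proof.
move=> /hits_first[m [mn wm firstm]].
have eqw k : (k <= n)%N -> extend (default_letter M) (mkseq w n.+1) k = w k.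
  by move=> kn; rewrite /extend nth_mkseq.
rewrite (goal_wgtE wm firstm) (@goal_wgtE _ m).
- rewrite !prefix_wgt_mkseq mkseq_extend ?size_mkseq 1?ltnW//.
  by rewrite /mkseq -map_take take_iota (minn_idPl _) 1?ltnW.
- by rewrite /visits eqw.
- by move=> k km; rewrite /visits eqw ?firstm// ltnW// (leq_trans km).
Qed.

(* Along paths of positive probability, a visit to [goal] is never left and the
   weight does not change afterwards. *)
Definition goal_stays h t := forall i, (i < size h)%N ->
  (nth (default_letter M) h i).1 = goal -> t = goal /\ path_wgt (take i h) = path_wgt h.

Lemma goal_stays_rcons h s a t :
  goal_stays h s -> 0 < trans s a t -> goal_stays (rcons h (s, a)) t.
Proof.
move=> hs st i; rewrite size_rcons ltnS nth_rcons leq_eqVlt => /predU1P[->|ih].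
  rewrite ltnn eqxx /= => sg; subst s.
  have [-> w0] := absorbing_step goal_abs st.
  by rewrite -cats1 take_size_cat// path_wgt_cat path_wgt_cons path_wgt_nil /= w0
    !addr0.
rewrite ih => /(hs _ ih)[sg wh]; subst s.
have [-> w0] := absorbing_step goal_abs st.
by rewrite -cats1 takel_cat 1?ltnW// path_wgt_cat path_wgt_cons path_wgt_nil /= w0
  !addr0.
Qed.

(** Since [goal] is never left and costs nothing afterwards, the final state and the total weight
    suffice: no first hitting time occurs in the payoff. *)
Definition at_goal phi h s : R := phi (path_wgt h) * (s == goal)%:R.

(** In an infinite word a state is visible only together with the action taken there, so the last
    state [t] is read off from one additional letter [(t, a)] with an arbitrary action. *)
Lemma goal_wgt_stays phi h t a : goal_stays h t ->
  let w := extend (default_letter M) (rcons h (t, a)) in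
  phi (goal_wgt goal w) * (hits (size h) w)%:R = at_goal phi h t.
Proof.
move=> ht w; rewrite /at_goal.
have wl : w (size h) = (t, a) by rewrite /w /extend nth_rcons ltnn eqxx.
have wi i : (i < size h)%N -> w i = nth (default_letter M) h i.
  by move=> ih; rewrite /w /extend nth_rcons ih.
have [hit|nohit] := boolP (hits (size h) w); last first.
  rewrite mulr0; case: eqP => [tg|_]; last by rewrite mulr0.
  case/negP: nohit; apply/existsP; exists ord_max.
  by rewrite /visits /= wl tg.
have [m [mh wm firstm]] := hits_first hit.
rewrite (goal_wgtE wm firstm) prefix_wgt_mkseq mkseq_extend; last first.
  by rewrite size_rcons ltnW.
move: mh; rewrite leq_eqVlt => /predU1P[mh|mh].
  rewrite mh /visits wl /= in wm *; rewrite wm -cats1 take_size_cat//.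
rewrite /visits wi// in wm; have [-> <-] := ht _ mh (eqP wm).
by rewrite eqxx -cats1 takel_cat// ltnW.
Qed.

(** The payoff restricted to words that hit [goal] by time [n] increases to the full payoff, and its
    integral is an expectation over [n.+1] letters. *)
Lemma cvg_reach S s phi : (forall z, 0 <= phi z) ->
  ((pexp S [::] s n (at_goal phi))%:E @[n --> \oo] -->
   \int[Pr S s]_(w in ev_reach goal) (phi (goal_wgt goal w))%:E)%E.
Proof.
move=> phi0.
have -> : (\int[Pr S s]_(w in ev_reach goal) (phi (goal_wgt goal w))%:E =
  \int[Pr S s]_w (phi (goal_wgt goal w) * \1_(ev_reach goal) w)%:E)%E.
  rewrite integral_mkcond; apply: eq_integral => w _.
  by rewrite patchE indicE; case: ifP => _; rewrite ?mulr1 ?mulr0.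
pose g n (w : infpath M) : R := phi (goal_wgt goal w) * (hits n w)%:R.
have -> : (fun n => (pexp S [::] s n (at_goal phi))%:E) =
  fun n => (pexp S [::] s n.+1 (fun h _ => g n (extend (default_letter M) h)))%:E.
  apply/funext => n; congr EFin; rewrite -addn1 pexp_cat.
  have eqF h t : size h = n -> goal_stays h t ->
      at_goal phi h t = pexp S h t 1 (fun h _ => g n (extend (default_letter M) h)).
    move=> hn ht /=.
    rewrite -[LHS](step_sum S h t); apply: eq_bigr => a _; congr (_ * _).
    apply: eq_bigr => t' _; congr (_ * _).
    by rewrite -(goal_wgt_stays phi a ht) hn.
  have gs h t a t' : goal_stays h t -> 0 < S h t a -> 0 < trans t a t' ->
      goal_stays (rcons h (t, a)) t'.
    by move=> ht _; exact: goal_stays_rcons.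
  apply/eqP; rewrite eq_le; apply/andP.
  by split; apply: (pexp_le_supp gs) => // u t un hu; rewrite eqF.
apply: cvg_integral_determined.
- by move=> n w; rewrite mulr_ge0.
- move=> n w; rewrite /g -hits_extend.
  by case: (boolP (hits n w)) => [/goal_wgt_extend <-|]; rewrite ?mulr0.
- move=> w m n mn; rewrite ler_wpM2l// ler_nat.
  by case: (boolP (hits m w)) => // /(hits_mono mn) ->.
- move=> w; rewrite indicE; case: (boolP (w \in ev_reach goal)).
    rewrite inE => -[m wm]; exists m => // n /= mn; congr (_ * _).
    suff -> : hits n w by [].
    by apply/existsP; exists (Ordinal (mn : (m < n.+1)%N)).
  rewrite notin_setE => nw; apply: nearW => n; congr (_ * _).
  suff /negPf -> : ~~ hits n w by [].
  by apply/existsP => -[i wi]; apply: nw; exists i.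
Qed.

End reaching_goal.

(** * Bounds on conditional expectations from finite-horizon bounds *)

Section conditional_expectation.
Variables (R : realType) (M : mdp) (goal : state M).
Hypothesis goal_abs : absorbing goal.
Implicit Types (S : scheduler R M) (h : seq (letter M)) (s t : state M).
Implicit Types (a : action M) (phi : int -> R).

Definition posw (z : int) : R := Num.max z%:~R 0.
Definition negw (z : int) : R := Num.max (- z%:~R) 0.

Lemma posw_ge0 z : 0 <= posw z. Proof. by rewrite le_max lexx orbT. Qed.
Lemma negw_ge0 z : 0 <= negw z. Proof. by rewrite le_max lexx orbT. Qed.

Lemma posw_negw z : z%:~R = posw z - negw z.
Proof.
rewrite /posw /negw; move: (z%:~R : R) => x.
case/orP: (le_total 0 x) => x0.
  by rewrite (max_idPl x0) (max_idPr _) ?subr0// oppr_le0.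
by rewrite (max_idPr x0) (max_idPl _) ?sub0r ?opprK// oppr_ge0.
Qed.

Lemma at_goal_ge0 phi h s : (forall z, 0 <= phi z) -> 0 <= at_goal goal phi h s.
Proof. by move=> phi0; rewrite mulr_ge0. Qed.

Lemma pexp_goal_absorbed phi S h n :
  pexp S h goal n (at_goal goal phi) = phi (path_wgt h).
Proof.
rewrite -[RHS](pexp_cst S h goal n).
apply: (@pexp_eq_inv _ _ (fun h' s => s = goal /\ path_wgt h' = path_wgt h)) => //.
- move=> h' s a t [-> wh] _ gt; have [-> w0] := absorbing_step goal_abs gt.
  by rewrite path_wgt_rcons w0 addr0.
- by move=> h' s [-> wh]; rewrite /at_goal wh eqxx mulr1.
Qed.

Lemma pexp_at_goal_mono phi S h s m n : (forall z, 0 <= phi z) -> (m <= n)%N ->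
  pexp S h s m (at_goal goal phi) <= pexp S h s n (at_goal goal phi).
Proof.
move=> phi0 /subnKC <-; rewrite pexp_cat; apply: pexp_le => h' s'.
have [->|s'g] := eqVneq s' goal.
  by rewrite pexp_goal_absorbed /at_goal eqxx mulr1.
rewrite {1}/at_goal (negPf s'g) mulr0; apply: pexp_ge0 => *.
exact: at_goal_ge0.
Qed.

Lemma measurable_ev_reach : measurable (ev_reach goal).
Proof.
have -> : ev_reach goal = \bigcup_n [set w | visits goal w n].
  by apply/seteqP; split=> [w [n wn]|w [n _ wn]]; exists n.
apply: bigcup_measurable => n _; apply: sub_sigma_algebra; exists n.+1 => w w' ww'.
by rewrite /= /visits ww'.
Qed.

Lemma cvg_Pr_reach S s :
  ((pexp S [::] s n (at_goal goal (fun=> 1)))%:E @[n --> \oo] -->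
   Pr S s (ev_reach goal))%E.
Proof.
have := @cvg_reach R M goal goal_abs S s (fun=> 1) (fun=> ler01).
by rewrite integral_cst ?mul1e//; exact: measurable_ev_reach.
Qed.

Lemma cvg_pexp_le S s phi n (l : \bar R) : (forall z, 0 <= phi z) ->
  ((pexp S [::] s n (at_goal goal phi))%:E @[n --> \oo] --> l)%E ->
  ((pexp S [::] s n (at_goal goal phi))%:E <= l)%E.
Proof.
move=> phi0 pl; apply: (cvge_ge _ pl).
by exists n => // m /= nm; rewrite lee_fin pexp_at_goal_mono.
Qed.

Lemma Pr_reach_fin S s : Pr S s (ev_reach goal) \is a fin_num.
Proof. by apply: fin_num_measure; exact: measurable_ev_reach. Qed.

Lemma integral_reach_split S s :
  (\int[Pr S s]_(w in ev_reach goal) ((goal_wgt goal w)%:~R)%:E =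
   \int[Pr S s]_(w in ev_reach goal) (posw (goal_wgt goal w))%:E -
   \int[Pr S s]_(w in ev_reach goal) (negw (goal_wgt goal w))%:E)%E.
Proof.
rewrite integralE; congr (_ - _)%E; apply: eq_integral => w _.
  by rewrite funeposE EFin_max.
by rewrite funenegE EFin_max EFinN.
Qed.

(** Positive and negative parts converge separately. The bound [c] makes the negative integral
    finite, so that the third condition passes to the limit without a difference of infinities. *)
Lemma CE_ge S (c N : R) n0 :
  let s0 := s_init M in
  (forall n, (n0 <= n)%N ->
     [/\ pexp S [::] s0 n (at_goal goal negw) <= c,
         0 < pexp S [::] s0 n (at_goal goal (fun=> 1)) &
         0 <= pexp S [::] s0 n (at_goal goal (fun z => z%:~R - N))]) ->
  (0 < Pr S s0 (ev_reach goal))%E /\ (N%:E <= CE S goal)%E.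
Proof.
move=> s0 Sn; set P := Pr S s0 (ev_reach goal).
have Pgt0 : (0 < P)%E.
  have [_ p0 _] := Sn n0 (leqnn _).
  apply: lt_le_trans (@cvg_pexp_le S s0 (fun=> 1) n0 P _ _) => //.
  exact: cvg_Pr_reach.
split=> //; rewrite /CE -/s0 -/P integral_reach_split.
set A := (\int[_]_(_ in _) (posw _)%:E)%E; set B := (\int[_]_(_ in _) (negw _)%:E)%E.
have cA := @cvg_reach R M goal goal_abs S s0 posw posw_ge0; rewrite -/A in cA.
have cB := @cvg_reach R M goal goal_abs S s0 negw negw_ge0; rewrite -/B in cB.
have cP := @cvg_Pr_reach S s0; rewrite -/P in cP.
have B0 : (0 <= B)%E by apply: integral_ge0 => w _; rewrite lee_fin negw_ge0.
have Bfin : B \is a fin_num.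
  rewrite ge0_fin_numE//; apply: le_lt_trans (ltry c).
  apply: (cvge_le _ cB); exists n0 => // n /= /Sn[+ _ _].
  by rewrite lee_fin.
have Pfin := Pr_reach_fin S s0; rewrite -/P in Pfin.
have AB : (B + N%:E * P <= A)%E.
  have cBNP : ((pexp S [::] s0 n (at_goal goal negw))%:E +
      N%:E * (pexp S [::] s0 n (at_goal goal (fun=> 1%R)))%:E @[n --> \oo] -->
      B + N%:E * P)%E.
    apply: cvgeD => //; first by rewrite fin_num_adde_defl// fin_numM.
    exact: cvgeZl.
  apply: (lee_cvg_to cBNP cA); exists n0 => // n /= /Sn[_ _].
  rewrite -EFinM -EFinD lee_fin -subr_ge0 => /le_trans; apply.
  rewrite -pexpZ opprD -!pexpN -!pexpD; apply: pexp_le => h s /=.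
  rewrite /at_goal (posw_negw (path_wgt h)); lra.
rewrite -(fineK Pfin) -(fineK Bfin) in AB Pgt0 *.
case: A AB {cA} => [x||] //=.
  rewrite -EFinM -EFinD -EFinB -EFinM !lee_fin lte_fin in Pgt0 * => AB.
  by rewrite ler_pdivlMr//; lra.
by move=> _; rewrite gt0_mulye ?leey// lte_fin invr_gt0 -lte_fin.
Qed.

(** The negative part is dropped, and the delay [m] disappears in the limit. *)
Lemma CE_le S (K : R) m :
  let s0 := s_init M in
  (0 < Pr S s0 (ev_reach goal))%E ->
  (forall n, pexp S [::] s0 n (at_goal goal posw) <=
     K * pexp S [::] s0 (n + m) (at_goal goal (fun=> 1))) ->
  (CE S goal <= K%:E)%E.
Proof.
move=> s0 Pgt0 Sn; rewrite /CE -/s0 integral_reach_split.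
set P := Pr S s0 (ev_reach goal) in Pgt0 *.
set A := (\int[_]_(_ in _) (posw _)%:E)%E; set B := (\int[_]_(_ in _) (negw _)%:E)%E.
have cA := @cvg_reach R M goal goal_abs S s0 posw posw_ge0; rewrite -/A in cA.
have cP := @cvg_Pr_reach S s0; rewrite -/P in cP.
have B0 : (0 <= B)%E by apply: integral_ge0 => w _; rewrite lee_fin negw_ge0.
have A0 : (0 <= A)%E by apply: integral_ge0 => w _; rewrite lee_fin posw_ge0.
have Pfin := Pr_reach_fin S s0; rewrite -/P in Pfin.
have AK : (A <= K%:E * P)%E.
  have cKP : (K%:E * (pexp S [::] s0 (n + m) (at_goal goal (fun=> 1%R)))%:E
      @[n --> \oo] --> K%:E * P)%E.
    by apply: cvgeZl => //; move: cP; rewrite -(cvg_shiftn m).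
  apply: (lee_cvg_to cA cKP); apply: nearW => n.
  by rewrite -EFinM lee_fin.
rewrite -(fineK Pfin) in AK Pgt0 *; rewrite lte_fin in Pgt0.
apply: (@le_trans _ _ (A * (fine P)^-1%:E)%E).
  apply: lee_wpmul2r; first by rewrite lee_fin invr_ge0 ltW.
  by rewrite -[leRHS]adde0 leeD2l// oppe_le0.
by rewrite lee_pdivrMr// -EFinM.
Qed.

End conditional_expectation.

(** * Schedulers *)

Section finite_uniformity.
Variable T : finType.

Lemma fin_uniform_nat (P : T -> nat -> Prop) :
  (forall x m n, (m <= n)%N -> P x m -> P x n) ->
  (forall x, exists n, P x n) -> exists n, forall x, P x n.
Proof.
move=> Pmono Pex; pose f x := sval (cid (Pex x)).
exists (\max_x f x) => x; apply: (Pmono x (f x)); first exact: leq_bigmax.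
exact: svalP (cid (Pex x)).
Qed.

Lemma fin_uniform_real (R : realDomainType) (P : T -> R -> Prop) :
  (forall x p q, 0 < p -> p <= q -> P x q -> P x p) ->
  (forall x, exists2 q, 0 < q & P x q) -> exists2 q, 0 < q & forall x, P x q.
Proof.
move=> Pmono Pex.
have [q q0 qP] : exists2 q, 0 < q & forall x, x \in enum T -> P x q.
  elim: (enum T) => [|x s [q q0 qP]]; first by exists 1.
  have [p p0 pP] := Pex x; exists (Num.min p q); first by rewrite lt_min p0.
  have m0 : 0 < Num.min p q by rewrite lt_min p0.
  move=> y; rewrite inE => /predU1P[->|/qP qy].
    by apply: Pmono pP => //; rewrite ge_min lexx.
  by apply: Pmono qy => //; rewrite ge_min lexx orbT.
by exists q => // x; apply: qP; rewrite mem_enum.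
Qed.

Lemma ler_sum1 (R : numDomainType) (f : T -> R) i :
  (forall j, 0 <= f j) -> f i <= \sum_j f j.
Proof. by move=> f0; rewrite (bigD1 i)//= lerDl sumr_ge0. Qed.

End finite_uniformity.

(** * Composing schedulers and comparing their expectations *)

Section scheduler_constructions.
Variables (R : realType) (M : mdp).
Implicit Types (S : scheduler R M) (h p : seq (letter M)) (s t : state M).
Implicit Types (a : action M) (B : seq (letter M) -> state M -> {set action M}).

(** Both the scheduler consulted and the history shown to it may depend on the true history; every
    scheduler composed from others below has this form. *)
Definition reroute (Sf : seq (letter M) -> state M -> scheduler R M)
    (f : seq (letter M) -> seq (letter M)) : scheduler R M :=
  @Scheduler R M (fun h s a => Sf h s (f h) s a)
    (fun h s a => choice_ge0 (Sf h s) (f h) s a)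
    (fun h s => choice_sum (Sf h s) (f h) s)
    (fun h s a => @choice_enabled R M (Sf h s) (f h) s a).

(* Where [B] offers no enabled action, all enabled actions are used. *)
Definition effective B h s :=
  let X := [set a in B h s | enabled s a]%SET in
  if X == finset.set0 then [set a | enabled s a]%SET else X.

Lemma effective_enabled B h s a : a \in effective B h s -> enabled s a.
Proof. by rewrite /effective; case: ifP => _; rewrite !inE => // /andP[]. Qed.

Lemma effectiveE B h s a : (exists2 b, b \in B h s & enabled s b) ->
  (a \in effective B h s) = (a \in B h s) && enabled s a.
Proof.
move=> [b bB sb]; rewrite /effective; case: ifP => [/eqP/setP/(_ b)|_].
  by rewrite !inE bB sb.
by rewrite !inE.
Qed.

Lemma effective_card B h s : 0 < #|effective B h s|%:R :> R.
Proof.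
rewrite ltr0n card_gt0 /effective; case: ifP => [_|->//].
by have [a sa] := enabled_ex s; apply/set0Pn; exists a; rewrite inE.
Qed.

Definition uniform_choice B h s a : R :=
  (a \in effective B h s)%:R / #|effective B h s|%:R.

Fact uniform_choice_ge0 B h s a : 0 <= uniform_choice B h s a.
Proof. by rewrite divr_ge0. Qed.

Fact uniform_choice_sum B h s : \sum_a uniform_choice B h s a = 1.
Proof.
rewrite -mulr_suml (_ : \sum_a _ = #|effective B h s|%:R).
  by rewrite divff// gt_eqF// effective_card.
rewrite -sum1_card natr_sum [RHS]big_mkcond; apply: eq_bigr => a _.
by case: (a \in _).
Qed.

Fact uniform_choice_enabled B h s a : 0 < uniform_choice B h s a -> enabled s a.
Proof.
rewrite /uniform_choice; case: (boolP (a \in _)) => [/effective_enabled//|_].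
by rewrite mul0r ltxx.
Qed.

Definition uniform B : scheduler R M :=
  @Scheduler R M (uniform_choice B) (uniform_choice_ge0 B) (uniform_choice_sum B)
    (@uniform_choice_enabled B).

Lemma uniform_gt0 B h s a : (0 < uniform B h s a) = (a \in effective B h s).
Proof.
rewrite /= /uniform_choice; case: (a \in _); last by rewrite mul0r ltxx.
by rewrite divr_gt0// effective_card.
Qed.

Lemma uniform1 B h s a : enabled s a -> B h s = [set a]%SET ->
  forall b, uniform B h s b = (b == a)%:R.
Proof.
move=> sa Ba b; have eff : effective B h s = [set a]%SET.
  apply/setP => c; rewrite effectiveE; last by exists a => //; rewrite Ba set11.
  by rewrite Ba inE; case: eqP => // ->; rewrite sa.
by rewrite /= /uniform_choice eff cards1 divr1 inE.
Qed.

(** A simulation argument: [f] translates histories, and on the invariant it commutes with extension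
    by a step and preserves choices and payoffs. *)
Lemma pexp_sim (f : seq (letter M) -> seq (letter M))
    (Inv : seq (letter M) -> state M -> Prop)
    (S S' : scheduler R M) F F' h s n :
  (forall h s a t, Inv h s -> 0 < S h s a -> 0 < trans s a t ->
     Inv (rcons h (s, a)) t) ->
  (forall h s a, Inv h s -> S h s a = S' (f h) s a) ->
  (forall h s a, Inv h s -> f (rcons h (s, a)) = rcons (f h) (s, a)) ->
  (forall h s, Inv h s -> F h s = F' (f h) s) ->
  Inv h s -> pexp S h s n F = pexp S' (f h) s n F'.
Proof.
move=> IS SS' fr FF'; elim: n h s => [|n IHn] h s I /=; first exact: FF'.
apply: eq_bigr => a _; rewrite SS'//; have := choice_ge0 S' (f h) s a.
rewrite le_eqVlt => /predU1P[<-|Sa]; first by rewrite !mul0r.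
congr (_ * _); apply: eq_bigr => t _; have := tprob_ge0 R s a t.
rewrite le_eqVlt => /predU1P[<-|st]; first by rewrite !mul0r.
rewrite IHn ?fr//; apply: IS => //; first by rewrite SS'.
by rewrite -(tprob_gt0 R).
Qed.

Definition residual S p : scheduler R M := reroute (fun _ _ => S) (cat p).

Lemma pexp_residual S p h s n F :
  pexp (residual S p) h s n (fun h' => F (p ++ h')) = pexp S (p ++ h) s n F.
Proof.
apply: (@pexp_sim _ (fun _ _ => True)) => // h' s' a _.
by rewrite rcons_cat.
Qed.

Lemma first_state_rcons h s a t : first_state (rcons h (s, a)) t = first_state h s.
Proof. by case: h. Qed.

Lemma first_state_cat h h' s :
  first_state (h ++ h') s = first_state h (first_state h' s).
Proof. by case: h. Qed.

(* Choose [a0] first, then behave like [Sf t] where [t] is the state reached. *)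
Definition first_step s0 a0 (Sf : state M -> scheduler R M) : scheduler R M :=
  reroute (fun h s => if h is _ :: h' then Sf (first_state h' s)
                      else uniform (fun _ _ => [set a0]%SET)) behead.

Lemma pexp_first_step s0 a0 Sf n F : enabled s0 a0 ->
  pexp (first_step s0 a0 Sf) [::] s0 n.+1 F =
  \sum_t tprob R s0 a0 t * pexp (Sf t) [::] t n (fun h => F ((s0, a0) :: h)).
Proof.
move=> sa; rewrite pexpS.
have choice1 b : first_step s0 a0 Sf [::] s0 b = (b == a0)%:R.
  exact: uniform1.
under eq_bigr do rewrite choice1.
rewrite (bigD1 a0)//= eqxx mul1r [X in _ + X]big1 ?addr0; last first.
  by move=> b /negPf ->; rewrite mul0r.
apply: eq_bigr => t _; congr (_ * _).
apply: (@pexp_sim behead (fun h s =>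
  exists2 h', h = (s0, a0) :: h' & first_state h' s = t)).
- move=> h s a t' [h' -> <-] _ _; exists (rcons h' (s, a)) => //.
  exact: first_state_rcons.
- by move=> h s a [h' -> <-].
- by move=> h s a [h' -> _].
- by move=> h s [h' -> _].
- by exists [::].
Qed.

End scheduler_constructions.

(** * Uniform exploration: reaching [goal] and bounded expected weight change *)

Section uniform_scheduler.
Variables (R : realType) (M : mdp) (goal : state M).
Hypothesis hM : standing_assumptions goal.
Implicit Types (h : seq (letter M)) (s t : state M) (a : action M).

Let goal_abs := goal_absorbing hM.

Definition maxw : nat := \max_(x : letter M) `|wgt x.1 x.2|%N.

Lemma absz_wgt_le s a : (`|wgt s a| <= maxw)%N.
Proof. exact: (@leq_bigmax _ (fun x : letter M => `|wgt x.1 x.2|%N) (s, a)). Qed.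

Lemma wgt_le s a : wgt s a <= maxw%:Z.
Proof. by have := absz_wgt_le s a; lia. Qed.

Lemma wgt_ge s a : - maxw%:Z <= wgt s a.
Proof. by have := absz_wgt_le s a; lia. Qed.

Lemma path_wgt_ge h : - (maxw * size h)%N%:Z <= path_wgt h.
Proof.
elim: h => [|x h IHh]; first by rewrite path_wgt_nil muln0.
by rewrite path_wgt_cons mulnS PoszD opprD lerD ?wgt_ge.
Qed.

Lemma path_wgt_le h : path_wgt h <= (maxw * size h)%N%:Z.
Proof.
elim: h => [|x h IHh]; first by rewrite path_wgt_nil muln0.
by rewrite path_wgt_cons mulnS PoszD lerD ?wgt_le.
Qed.

Definition explore : scheduler R M :=
  locked (uniform R (fun _ _ => [set: action M]%SET)).

Lemma explore_gt0 h s a : (0 < explore h s a) = enabled s a.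
Proof.
rewrite /explore -lock uniform_gt0 effectiveE ?inE//.
by have [b sb] := enabled_ex s; exists b; rewrite ?inE.
Qed.

(** The choices of [explore] do not depend on the history. *)
Lemma pexp_explore h s n F :
  pexp explore h s n F = pexp explore [::] s n (fun h' => F (h ++ h')).
Proof.
rewrite -[h in LHS]cats0 -pexp_residual.
apply: (@pexp_sim _ _ id (fun _ _ => True)) => // h' s' a _.
by rewrite /residual /explore -lock.
Qed.

Local Notation reached := (at_goal goal (fun=> 1)) (only parsing).

Lemma reached01 h s : 0 <= at_goal goal (fun=> 1 : R) h s <= 1.
Proof. by rewrite /at_goal mul1r; case: (s == goal); rewrite ?lexx ?ler01. Qed.

(** A path to [goal] is followed with positive probability; finiteness of the state set makes its
    length and probability uniform, and absorption keeps the bound valid at later horizons. *)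
Lemma explore_goal : exists K, exists2 q : R, 0 < q &
  forall h s n, reachable s goal -> (K <= n)%N -> q <= pexp explore h s n reached.
Proof.
pose Q s n q := reachable s goal -> q <= pexp explore [::] s n reached.
have [K] : exists K, forall s, exists2 q : R, 0 < q & Q s K q.
  apply: fin_uniform_nat => [s m n mn [q q0 qm]|s].
    exists q => // /qm/le_trans; apply.
    by apply: pexp_at_goal_mono => // *; exact: ler01.
  have [/connectP[p]|nsg] := boolP (reachable s goal); last first.
    by exists 0%N, 1 => // /(negP nsg).
  elim: p s => [|t p IHp] s /=.
    by move=> _ <-; exists 0%N, 1 => // _; rewrite /= /at_goal eqxx mulr1.
  move=> /andP[/existsP[a /andP[sa st]] tp gl].
  have [n [q q0 Qn]] := IHp t tp gl.
  exists n.+1, (explore [::] s a * (tprob R s a t * q)).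
    by apply: mulr_gt0; [rewrite explore_gt0|apply: mulr_gt0; rewrite ?tprob_gt0].
  move=> _; rewrite pexpS.
  have pge0 t' b : 0 <= tprob R s b t' * pexp explore [:: (s, b)] t' n reached.
    rewrite mulr_ge0 ?tprob_ge0// pexp_ge0// => h s'.
    by case/andP: (reached01 h s').
  apply: le_trans (ler_sum1 a _); last first.
    by move=> b; apply: mulr_ge0; [exact: choice_ge0|exact: sumr_ge0].
  apply: ler_wpM2l; first exact: choice_ge0.
  apply: le_trans (ler_sum1 t _) => //.
  rewrite ler_wpM2l ?tprob_ge0// pexp_explore; apply: Qn.
  by apply/connectP; exists p.
move=> /fin_uniform_real[s p q _ pq Qq /Qq|]; first exact: le_trans.
move=> q q0 Qq; exists K, q => // h s n sg Kn; rewrite pexp_explore.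
apply: le_trans (Qq s sg) _; apply: pexp_at_goal_mono => //.
Qed.

Definition terminal s := (s == goal) || ~~ reachable s goal.

Lemma terminal_absorbing s : terminal s -> absorbing s.
Proof. by move=> /orP[/eqP ->|/(fail_absorbing hM)]. Qed.

(** The weight changes only in nonterminal states, and the expected time spent there is bounded
    because from each of them [goal] is reached within [K] steps with probability at least [q]. *)
Lemma explore_wgt : exists2 C : R, 0 <= C & forall h s n,
  pexp explore h s n (fun h' _ => `|(path_wgt h' - path_wgt h)%:~R|) <= C.
Proof.
have [K [q q0 qP]] := explore_goal.
pose nt n s : R := pexp explore [::] s n (fun _ t => (~~ terminal t)%:R).
have nt_ge0 n s : 0 <= nt n s by apply: pexp_ge0.
have nt_le1 n s : nt n s <= 1.
  by rewrite -[leRHS](pexp_cst explore [::] s n 1); apply: pexp_le => *;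
     case: (terminal _).
have ntK n s : nt (n + K)%N s <= (1 - q) * nt n s.
  rewrite /nt pexp_cat -pexpZ; apply: pexp_le => h t.
  have [tt|tt] := boolP (terminal t); last first.
    rewrite mulr1; have tg : reachable t goal.
      by move: tt; rewrite negb_or negbK => /andP[].
    rewrite lerBrDl; apply: le_trans (_ : pexp explore h t K (fun _ _ => 1) <= _).
      apply: le_trans (_ : pexp explore h t K (fun h' s' =>
          at_goal goal (fun=> 1) h' s' + (~~ terminal s')%:R) <= _).
        by rewrite pexpD lerD2r; exact: qP.
      apply: pexp_le => h' s'; rewrite /at_goal mul1r /terminal.
      by case: eqP => //=; rewrite ?addr0 ?add0r ?negbK//; case: (reachable _ _).
    by rewrite pexp_cst.
  rewrite mulr0; apply: le_trans (_ : pexp explore h t K (fun _ _ => 0) <= _).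
    apply: (@pexp_le_inv _ _ (fun _ s' => s' = t)) => //.
      move=> _ _ a t' -> _ tt'.
      by have [] := absorbing_step (terminal_absorbing tt) tt'.
    by move=> _ _ ->; rewrite tt.
  by rewrite pexp_cst.
(* [Y n s] is the expected number of nonterminal states among the first [n]. Comparing [Y n s] with
   [Y (n + K) s] bounds it by [K / q]. *)
pose Y n s := \sum_(i < n) nt i s.
have Yle n s : Y n s <= K%:R / q.
  rewrite ler_pdivlMr//.
  have YK : Y (n + K)%N s <= K%:R + (1 - q) * Y n s.
    rewrite addnC /Y big_split_ord /=; apply: lerD.
      rewrite -[leRHS]mulr1 -[K in K%:R]card_ord -sumr_const mulr_suml.
      by apply: ler_sum => i _; rewrite mul1r.
    by rewrite mulr_sumr; apply: ler_sum => i _; rewrite addnC.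
  have : Y n s <= Y (n + K)%N s.
    by rewrite /Y big_split_ord /= lerDl sumr_ge0.
  move: (Y n s) (Y (n + K)%N s) YK => x y; nra.
(* Each nonterminal step moves the weight by at most [maxw]; the induction splits [Y] at its first
   step. *)
have D n s : pexp explore [::] s n (fun h _ => `|(path_wgt h)%:~R|) <= maxw%:R * Y n s.
  elim: n s => [|n IHn] s.
    by rewrite /= path_wgt_nil normr0 mulr_ge0// sumr_ge0.
  have -> : Y n.+1 s = nt 0%N s + \sum_a explore [::] s a *
      \sum_t tprob R s a t * Y n t.
    rewrite /Y big_ord_recl; congr (_ + _).
    under eq_bigr => i _.
      rewrite /nt /=; under eq_bigr do under eq_bigr do rewrite pexp_explore.
      over.
    rewrite exchange_big; apply: eq_bigr => a _ /=.
    rewrite -mulr_sumr; congr (_ * _); rewrite exchange_big.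
    by apply: eq_bigr => t _; rewrite -mulr_sumr.
  rewrite pexpS mulrDr -(step_sum explore [::] s (maxw%:R * nt 0%N s)).
  rewrite mulr_sumr -big_split /=; apply: ler_sum => a _.
  rewrite mulrCA -mulrDr ler_wpM2l ?choice_ge0// mulr_sumr -big_split /=.
  apply: ler_sum => t _; have := tprob_ge0 R s a t.
  rewrite le_eqVlt => /predU1P[<-|]; first by rewrite !mul0r mulr0 addr0.
  rewrite tprob_gt0 => st; rewrite [X in _ + X]mulrCA -mulrDr ler_wpM2l ?tprob_ge0//.
  rewrite pexp_explore; apply: le_trans (_ : _ <= maxw%:R * (~~ terminal s)%:R +
      pexp explore [::] t n (fun h _ => `|(path_wgt h)%:~R|)) _; last first.
    by rewrite lerD2l IHn.
  rewrite -[X in X + _](pexp_cst explore [::] t n) -pexpD; apply: pexp_le => h _.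
  rewrite path_wgt_cons rmorphD /=; apply: le_trans (ler_normD _ _) _.
  rewrite lerD2r; have [ts|ts] := boolP (terminal s); last first.
    rewrite mulr1 -intr_norm; change (maxw%:R : R) with ((maxw%:Z)%:~R : R).
    rewrite ler_int; have := wgt_le s a; have := wgt_ge s a; lia.
  by have [_ ->] := absorbing_step (terminal_absorbing ts) st; rewrite normr0 mulr0.
exists (maxw%:R * (K%:R / q)) => [|h s n]; first by rewrite mulr_ge0// divr_ge0// ltW.
rewrite pexp_explore; apply: le_trans (le_trans (D n s) _).
  by apply: pexp_le => h' _; rewrite path_wgt_cat addrAC subrr add0r.
by rewrite ler_wpM2l.
Qed.

End uniform_scheduler.

(** * Pumping positive cycles *)

Section pumping.
Variables (R : realType) (M : mdp) (goal : state M).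
Hypothesis hM : standing_assumptions goal.
Implicit Types (S : scheduler R M) (h : seq (letter M)) (s t u : state M).
Implicit Types (a : action M) (phi : int -> R).

Local Notation one := (fun=> 1 : R).
Local Notation reached := (at_goal goal one).
Local Notation explore := (explore R M).

Let goal_abs := goal_absorbing hM.

Lemma at_goal_cons phi x h s :
  at_goal goal phi (x :: h) s = at_goal goal (fun z => phi (wgt x.1 x.2 + z)) h s.
Proof. by rewrite /at_goal path_wgt_cons. Qed.

Lemma pexp_reached_ge0 S h s n : 0 <= pexp S h s n reached.
Proof. by apply: pexp_ge0 => *; apply: at_goal_ge0 => *; exact: ler01. Qed.

Lemma pexp_reached_le1 S h s n : pexp S h s n reached <= 1.
Proof.
rewrite -[leRHS](pexp_cst S h s n 1); apply: pexp_le => h' s'.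
by case/andP: (reached01 R goal h' s').
Qed.

(** If the nonnegative terms summing to the reaching probability all vanish, so does every payoff
    collected at [goal], whatever its sign. *)
Lemma pexp_reached0 S h s n phi :
  pexp S h s n reached = 0 -> pexp S h s n (at_goal goal phi) = 0.
Proof.
elim: n h s => [|n IHn] h s.
  by rewrite /= /at_goal mul1r => ->; rewrite mulr0.
have tge0 a t : 0 <= tprob R s a t * pexp S (rcons h (s, a)) t n reached.
  by rewrite mulr_ge0 ?tprob_ge0 ?pexp_reached_ge0.
have age0 a : 0 <= \sum_t tprob R s a t * pexp S (rcons h (s, a)) t n reached.
  exact: sumr_ge0.
rewrite !pexpS => /eqP; rewrite psumr_eq0 => [/allP Sa0|a _]; last first.
  by rewrite mulr_ge0 ?choice_ge0.
apply: big1 => a _; have /implyP := Sa0 a (mem_index_enum a).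
move=> /(_ isT); rewrite mulf_eq0 => /orP[/eqP ->|]; first by rewrite mul0r.
rewrite psumr_eq0// => /allP T0; rewrite big1 ?mulr0// => t _.
have /implyP := T0 t (mem_index_enum t).
move=> /(_ isT); rewrite mulf_eq0 => /orP[/eqP ->|/eqP]; first by rewrite mul0r.
by move=> /IHn ->; rewrite mulr0.
Qed.

Lemma negw_le_norm (z : int) : negw R z <= `|z%:~R|.
Proof. by rewrite ge_max normr_ge0 -normrN ler_norm. Qed.

Lemma negw_leD (x y : int) : negw R (x + y) <= `|x%:~R| + negw R y.
Proof.
rewrite /negw ge_max; apply/andP; split; last first.
  by rewrite addr_ge0// le_max lexx orbT.
rewrite rmorphD opprD lerD//; last by rewrite le_max lexx.
by rewrite -normrN ler_norm.
Qed.

Lemma posw_geD (x y : int) : posw R y - `|x%:~R| <= posw R (x + y).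
Proof.
rewrite lerBlDr /posw ge_max; apply/andP; split; last first.
  by rewrite addr_ge0// le_max lexx orbT.
apply: le_trans (_ : (x + y)%:~R + `|x%:~R| <= _).
  rewrite rmorphD /=; have := ler_norm (- x%:~R : R); rewrite normrN; lra.
by rewrite lerD2r le_max lexx.
Qed.

Lemma norm_wgt_le s a : `|(wgt s a)%:~R| <= (maxw M)%:R :> R.
Proof.
rewrite -intr_norm; change ((maxw M)%:R : R) with ((Posz (maxw M))%:~R : R).
by rewrite ler_int; have := absz_wgt_le s a; lia.
Qed.

(** From a nonnegative weight, a negative part at [goal] is at most the change in weight since
    then. *)
Lemma explore_negw : exists2 C : R, 0 <= C & forall h s n, 0 <= path_wgt h ->
  pexp explore h s n (at_goal goal (negw R)) <= C.
Proof.
have [C C0 CP] := explore_wgt R hM; exists C => // h s n h0.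
apply: le_trans (CP h s n); apply: pexp_le => h' s'.
rewrite /at_goal -[leRHS]mulr1; apply: ler_pM => //; first exact: negw_ge0.
  set d := path_wgt h' - path_wgt h.
  have -> : path_wgt h' = path_wgt h + d by rewrite addrC subrK.
  apply: (@le_trans _ _ (negw R d)).
    rewrite /negw ge_max [X in _ && X]le_max lexx orbT andbT le_max.
    by apply/orP; left; rewrite lerN2 ler_int lerDr.
  exact: negw_le_norm.
by case: (s' == goal); rewrite ?ler01.
Qed.

(* By [CE_ge], such a scheduler started in [s] has conditional expectation at
   least [N]. *)
Definition gains s (N : R) := exists S c n0, forall n, (n0 <= n)%N ->
  [/\ pexp S [::] s n (at_goal goal (negw R)) <= c,
      0 < pexp S [::] s n reached &
      0 <= pexp S [::] s n (at_goal goal (fun z => z%:~R - N))].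

Lemma gains_CE N : gains (s_init M) N -> (N%:E <= CE_sup R goal)%E.
Proof.
move=> [S [c [n0 Sn]]]; have [P0 NCE] := @CE_ge R M goal goal_abs S c N n0 Sn.
by apply: le_trans NCE _; apply: ereal_sup_ubound; exists S.
Qed.

Lemma gains_unbounded : (forall N, gains (s_init M) N) -> ~ CE_sup R goal \is a fin_num.
Proof.
move=> gainsN CEfin; have := gains_CE (gainsN (fine (CE_sup R goal) + 1)).
by rewrite -(fineK CEfin) lee_fin gerDl ler10.
Qed.

Lemma pexp_at_goalB S h s n N :
  pexp S h s n (at_goal goal (fun z => z%:~R - N)) =
  pexp S h s n (at_goal goal (posw R)) - pexp S h s n (at_goal goal (negw R))
  - N * pexp S h s n reached.
Proof.
rewrite -pexpZ -!pexpN -!pexpD; apply: eq_pexp => h' s'.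
by rewrite /at_goal (posw_negw R (path_wgt h')); lra.
Qed.

(** Exploration has negative part at most [C] and reaches [goal] with probability at least [q],
    hence conditional expectation at least [- (C / q)]. This is the base value for pumping. *)
Lemma explore_gains : exists N, forall s, reachable s goal -> gains s N.
Proof.
have [C C0 CP] := explore_negw; have [K [q q0 qP]] := explore_goal R hM.
exists (- (C / q)) => s sg; exists explore, C, K => n Kn.
have Cn := CP [::] s n; rewrite path_wgt_nil lexx in Cn.
have qn := qP [::] s n sg Kn; split; first exact: Cn.
  exact: lt_le_trans qn.
rewrite pexp_at_goalB.
have : 0 <= pexp explore [::] s n (at_goal goal (posw R)).
  by apply: pexp_ge0 => *; apply: at_goal_ge0; exact: posw_ge0.
have : C <= C / q * pexp explore [::] s n reached.
  by rewrite mulrAC ler_pdivlMr// ler_wpM2l.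
by have := Cn isT; lra.
Qed.

Definition avoidable u := exists S, forall n, pexp S [::] u n reached = 0.

(** After [a], the goal is avoided from every successor other than [t]. All expectations are then
    scaled by the probability of [t], which cancels under conditioning, and only the weight of [a]
    is added. *)
Lemma gains_step s a t N : 0 < trans s a t ->
  (forall u, 0 < trans s a u -> avoidable u) ->
  gains t N -> gains s (N + (wgt s a)%:~R).
Proof.
move=> st av [S [c [n0 Sn]]]; have sa := trans_enabled st.
(* The final default [S] concerns only states that [a] reaches with probability 0. *)
pose Sf u := if u == t then S else
  if pselect (avoidable u) is left e then sval (cid e) else S.
have off u phi n : u != t -> tprob R s a u *
    pexp (Sf u) [::] u n (at_goal goal phi) = 0.
  move=> ut; have := tprob_ge0 R s a u; rewrite le_eqVlt => /predU1P[<-|].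
    by rewrite mul0r.
  rewrite tprob_gt0 => /av av_u; rewrite pexp_reached0 ?mulr0// /Sf (negPf ut).
  by case: pselect => // e; exact: (svalP (cid e)).
have stepE phi n : pexp (first_step s a Sf) [::] s n.+1 (at_goal goal phi) =
    tprob R s a t * pexp S [::] t n (at_goal goal (fun z => phi (wgt s a + z))).
  rewrite pexp_first_step// (bigD1 t)//= big1 ?addr0 => [|u ut].
    congr (_ * _); rewrite /Sf eqxx; apply: eq_pexp => h u.
    by rewrite at_goal_cons.
  rewrite -(off u (fun z => phi (wgt s a + z)) n ut); congr (_ * _).
  by apply: eq_pexp => h v; rewrite at_goal_cons.
have T0 : 0 < tprob R s a t by rewrite tprob_gt0.
exists (first_step s a Sf), (tprob R s a t * (`|(wgt s a)%:~R| + c)), n0.+1.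
case=> // n /Sn[nc np nN]; rewrite !stepE; split.
- rewrite ler_pM2l//; apply: le_trans (lerD (lexx _) nc).
  rewrite -[X in X + _](pexp_cst S [::] t n) -pexpD; apply: pexp_le => h u.
  rewrite /at_goal; case: (u == goal); rewrite ?mulr0 ?addr0// !mulr1.
  exact: negw_leD.
- exact: mulr_gt0.
- rewrite pmulr_rge0//; apply: le_trans nN _; apply: pexp_le => h u.
  by rewrite /at_goal rmorphD /= ler_wpM2r//; lra.
Qed.

Lemma gains_path h s N : is_path h s ->
  (forall x, x \in h -> forall u, 0 < trans x.1 x.2 u -> avoidable u) ->
  gains s N -> gains (first_state h s) (N + (path_wgt h)%:~R).
Proof.
elim: h => [|[s0 a] h IHh] /=; first by rewrite path_wgt_nil addr0.
move=> /andP[st hs] av gN; rewrite path_wgt_cons rmorphD /= addrCA addrC.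
apply: gains_step st _ _; first by apply: (av (s0, a)); rewrite mem_head.
by apply: IHh => // x xh; apply: av; rewrite inE xh orbT.
Qed.

Lemma is_path_cat h h' s :
  is_path (h ++ h') s = is_path h (first_state h' s) && is_path h' s.
Proof.
by elim: h => [|[s0 a] h IHh] //=; rewrite first_state_cat IHh andbA.
Qed.

Lemma absorbing_path h s : absorbing (first_state h s) -> is_path h s ->
  path_wgt h = 0.
Proof.
elim: h => [|[s0 a] h IHh] /=; first by rewrite path_wgt_nil.
move=> abs /andP[st hs]; rewrite path_wgt_cons /=.
have [e ->] := absorbing_step abs st.
by rewrite add0r IHh// e.
Qed.

Lemma sched_path_catl S h h' s :
  sched_path S (h ++ h') s -> sched_path S h (first_state h' s).
Proof.
move=> [hp Sp]; split; first by move: hp; rewrite is_path_cat => /andP[].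
by move=> h1 s' a h2 e; apply: (Sp h1 s' a (h2 ++ h')); rewrite e -catA.
Qed.

(** A positive chance of reaching [goal] after an [S]-path would give a positive chance from its
    first state. *)
Lemma avoiding_path S h s :
  (forall n, pexp S [::] (first_state h s) n reached = 0) ->
  sched_path S h s -> forall n, pexp S h s n reached = 0.
Proof.
elim/last_ind: h s => // h [s0 a] IHh s; rewrite first_state_rcons => S0 Sp n.
have Sh : sched_path S h s0.
  by have := @sched_path_catl S h [:: (s0, a)] s; rewrite cats1; exact.
have := IHh s0 S0 Sh n.+1; rewrite pexpS => /eqP.
have Sa : 0 < S h s0 a by have [_] := Sp; apply; rewrite -cats1.
have st : 0 < tprob R s0 a s.
  have [+ _] := Sp; rewrite -cats1 is_path_cat => /andP[_] /=.
  by rewrite andbT tprob_gt0.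
have tge0 b t : 0 <= tprob R s0 b t * pexp S (rcons h (s0, b)) t n reached.
  by rewrite mulr_ge0 ?tprob_ge0 ?pexp_reached_ge0.
rewrite psumr_eq0 => [/allP|b _]; last first.
  by apply: mulr_ge0; [exact: choice_ge0|exact: sumr_ge0].
move=> /(_ a (mem_index_enum a)); rewrite /= mulf_eq0 gt_eqF//= psumr_eq0//.
by move=> /allP/(_ s (mem_index_enum s)); rewrite /= mulf_eq0 gt_eqF//= => /eqP.
Qed.

(** The residual of [S] after the extended path is the avoiding scheduler. *)
Lemma avoidable_successor S h s a u :
  (forall n, pexp S [::] (first_state h s) n reached = 0) ->
  sched_path S h s -> 0 < S h s a -> 0 < trans s a u -> avoidable u.
Proof.
move=> S0 [hp Sp] Sa su; exists (residual S (rcons h (s, a))) => n.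
have Su : sched_path S (rcons h (s, a)) u.
  split=> [|h1 s' b h2]; first by rewrite -cats1 is_path_cat /= hp su.
  elim/last_ind: h2 => [|h2 x _].
    by rewrite cats1 => /rcons_inj[<- <- <-].
  by rewrite -rcons_cons -rcons_cat => /rcons_inj[/Sp].
have : pexp S (rcons h (s, a)) u n reached = 0.
  by apply: avoiding_path => //; rewrite first_state_rcons.
rewrite -[rcons h _ in X in X -> _]cats0 -pexp_residual => E0.
apply: (@pexp_reached0 _ _ _ _ one); rewrite -[RHS]E0; apply: eq_pexp => h' s'.
by rewrite /at_goal.
Qed.

Lemma critical_gains S : critical goal S -> forall N, gains (s_init M) N.
Proof.
move=> [PS0 [h [s [Sh h0 [h1 [c [h2 [e c0 cyc cw]]]]]]]] N.
have S0 n : pexp S [::] (first_state h s) n reached = 0.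
  rewrite h0; apply/eqP; rewrite eq_le pexp_reached_ge0 andbT -lee_fin.
  apply: (@le_trans _ _ (Pr S (s_init M) (ev_reach goal))); last by rewrite PS0.
  by apply: cvg_pexp_le => //; exact: cvg_Pr_reach.
have av x : x \in h -> forall u, 0 < trans x.1 x.2 u -> avoidable u.
  move=> xh u; case/splitPr: xh (S0) (Sh) => p1 p2 S0' Sp xu.
  have Sp1 := sched_path_catl Sp; have [_ Sx] := Sp.
  apply: (@avoidable_successor S p1 x.1 x.2 u) => //.
    by rewrite first_state_cat in S0'; case: x {xu Sx} S0' Sp Sp1.
  by apply: (Sx p1 _ _ p2); case: x {xu Sx Sp Sp1 S0'}.
set x := first_state h2 s in cyc.
have [hp _] := Sh; move: hp; rewrite e !is_path_cat => /and3P[h1p cp h2p].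
rewrite -/x in cp; rewrite first_state_cat -/x in cyc h1p; rewrite cyc in h1p.
(* Otherwise [x] would be absorbing, and a cycle through it would have weight 0. *)
have xg : reachable x goal.
  apply/negPn/negP => /(fail_absorbing hM) xabs; move: cw.
  by rewrite (@absorbing_path c x)// cyc.
have [N0 gN0] := explore_gains.
have pump k : gains x (N0 + (k%:Z * path_wgt c)%:~R).
  elim: k => [|k IHk]; first by rewrite mul0r addr0; exact: gN0.
  have := gains_path cp _ IHk; rewrite cyc -addrA -rmorphD /= intS mulrDl mul1r.
  rewrite [path_wgt c + _]addrC; apply => y yc; apply: av.
  by rewrite e !mem_cat yc orbT.
have mono t N1 N2 : N1 <= N2 -> gains t N2 -> gains t N1.
  move=> N12 [S' [b [n0 Sn]]]; exists S', b, n0 => n /Sn[? ? N2n]; split=> //.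
  apply: le_trans N2n _; apply: pexp_le => h' s'.
  by rewrite ler_wpM2r// lerD2l lerN2.
have gx : gains x (N - (path_wgt h1)%:~R).
  pose r := N - (path_wgt h1)%:~R - N0.
  (* The cycle has integer weight at least 1, so as many turns as the missing amount [r] suffice. *)
  apply: mono (pump (Num.bound `|r|)); rewrite -lerBlDl -/r.
  apply: (@le_trans _ _ (Num.bound `|r|)%:R).
    exact: le_trans (ler_norm r) (ltW (archi_boundP (normr_ge0 _))).
  change ((Posz (Num.bound `|r|))%:~R <= ((Num.bound `|r|)%:Z * path_wgt c)%:~R :> R).
  by rewrite ler_int ler_peMr//; lia.
have := gains_path h1p _ gx; rewrite subrK.
rewrite -h0 e !first_state_cat -/x cyc; apply => y yh; apply: av.
by rewrite e mem_cat yh.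
Qed.

End pumping.

(** * Divergent end components make the conditional expectation infinite *)

Section weight_divergence.
Variables (R : realType) (M : mdp) (goal : state M).
Hypothesis hM : standing_assumptions goal.
Implicit Types (S : scheduler R M) (h : seq (letter M)) (s t u : state M).
Implicit Types (a : action M) (phi : int -> R).

Local Notation one := (fun=> 1 : R).
Local Notation reached := (at_goal goal one).
Local Notation explore := (explore R M).

Let goal_abs := goal_absorbing hM.

(** All prefixes count, including the empty one and [h] itself, so that passing is permanent even if
    the weight drops later. *)
Definition passed (N : int) h : bool :=
  has (fun i => N <= path_wgt (take i h)) (iota 0 (size h).+1).

Lemma passed_nil N : passed N [::] = (N <= 0).
Proof. by rewrite /passed /= path_wgt_nil orbF. Qed.

Lemma passed_rcons N h x :
  passed N (rcons h x) = passed N h || (N <= path_wgt (rcons h x)).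
Proof.
rewrite /passed size_rcons -[in iota _ _]addn1 iotaD has_cat [X in _ || X]/=
  orbF add0n.
rewrite take_oversize ?size_rcons//; congr (_ || _).
apply: eq_in_has => i; rewrite mem_iota add0n ltnS => ih.
by rewrite -cats1 takel_cat.
Qed.

Lemma passed_wgt N h : N <= path_wgt h -> passed N h.
Proof.
move=> Nh; apply/hasP; exists (size h); last by rewrite take_size.
by rewrite mem_iota add0n ltnS leqnn.
Qed.

Lemma measurable_ev_wgt_ge (N : nat) : measurable (@ev_wgt_ge M N).
Proof.
have -> : @ev_wgt_ge M N = \bigcup_n [set w | N%:Z <= prefix_wgt w n].
  by apply/seteqP; split=> [w [n wn]|w [n _ wn]]; exists n.
apply: bigcup_measurable => n _; apply: sub_sigma_algebra; exists n => w w' ww'.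
rewrite /= !prefix_wgt_mkseq; suff -> : mkseq w n = mkseq w' n by [].
by apply/eq_in_map => i; rewrite mem_iota add0n => /ww'.
Qed.

Lemma cvg_passed S s (N : nat) :
  ((pexp S [::] s n (fun h _ => (passed N h)%:R))%:E @[n --> \oo] -->
   Pr S s (@ev_wgt_ge M N))%E.
Proof.
have mk w n i : (i <= n)%N -> take i (mkseq w n) = mkseq w i :> seq (letter M).
  by move=> ile; rewrite /mkseq -map_take take_iota (minn_idPl ile).
pose g n (w : infpath M) : R := (passed N (mkseq w n))%:R.
have mev := measurable_ev_wgt_ge N.
have -> : Pr S s (@ev_wgt_ge M N) =
    (\int[Pr S s]_w (\1_(@ev_wgt_ge M N) w)%:E)%E.
  by rewrite integral_indic// setIT.
have -> : (fun n => (pexp S [::] s n (fun h _ => (passed N h)%:R))%:E) =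
    fun n => (pexp S [::] s n (fun h _ => g n (extend (default_letter M) h)))%:E.
  apply/funext => n; congr EFin; apply/eqP; rewrite eq_le.
  by apply/andP; split; apply: pexp_le_cat => u s' un;
    rewrite /g mkseq_extend ?un ?take_oversize ?un.
apply: (@cvg_integral_determined _ _ _ _ _ g id) => //.
- move=> n w; rewrite /g /= mkseq_extend ?size_mkseq// take_oversize//.
  by rewrite size_mkseq.
- move=> w m n mn; rewrite /g ler_nat; case: (boolP (passed N (mkseq w m))) => //.
  move=> /hasP[i]; rewrite size_mkseq mem_iota add0n ltnS => im.
  rewrite mk// => Ni; suff -> : passed N (mkseq w n) by [].
  apply/hasP; exists i; last by rewrite mk// (leq_trans im).
  by rewrite size_mkseq mem_iota add0n ltnS (leq_trans im).
- move=> w; rewrite indicE; case: (boolP (w \in _)).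
    rewrite inE => -[m]; rewrite prefix_wgt_mkseq => Nm; exists m => // n /= mn.
    rewrite /g; suff -> : passed N (mkseq w n) by [].
    apply/hasP; exists m; last by rewrite mk.
    by rewrite size_mkseq mem_iota add0n ltnS.
  rewrite notin_setE => nw; apply: nearW => n; rewrite /g.
  suff /negPf -> : ~~ passed N (mkseq w n) by [].
  apply/hasP => -[i]; rewrite size_mkseq mem_iota add0n ltnS => ile.
  by rewrite mk// -prefix_wgt_mkseq => Ni; apply: nw; exists i.
Qed.

Lemma passed_half S s (N : nat) : Pr S s (@ev_wgt_ge M N) = 1%E ->
  exists k, 2^-1 <= pexp S [::] s k (fun h _ => (passed N h)%:R).
Proof.
move=> P1; apply/not_existsP => small.
have : (Pr S s (@ev_wgt_ge M N) <= (2^-1)%:E)%E.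
  apply: (cvge_le _ (@cvg_passed S s N)); apply: nearW => n; rewrite lee_fin ltW//.
  by rewrite ltNge; apply/negP; exact: small.
by rewrite P1 lee_fin; lra.
Qed.

(** During the [K] steps in which [goal] is reached with probability at least [q], the weight drops
    by at most [maxw M * K]. *)
Lemma explore_posw : exists K, exists2 q : R, 0 < q &
  forall h s n (N : nat), reachable s goal -> (K <= n)%N -> N%:Z <= path_wgt h ->
  (N%:R - (maxw M * K)%:R) * q <= pexp explore h s n (at_goal goal (posw R)).
Proof.
have [K [q q0 qP]] := explore_goal R hM; exists K, q => // h s n N sg Kn Nh.
apply: (@le_trans _ _ (pexp explore h s K (at_goal goal (posw R)))); last first.
  by apply: pexp_at_goal_mono => //; exact: posw_ge0.
set c := _ - _; have [c0|c0] := leP 0 c; last first.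
  apply: le_trans (_ : 0 <= _); first by rewrite pmulr_lle0// ltW.
  by apply: pexp_ge0 => *; apply: at_goal_ge0; exact: posw_ge0.
apply: le_trans (_ : c * pexp explore h s K reached <= _).
  by rewrite ler_wpM2l// qP.
rewrite -pexpZ; apply: pexp_le_cat => u s' uK.
rewrite /at_goal mul1r ler_wpM2r// le_max; apply/orP; left.
have uW := path_wgt_ge u.
rewrite path_wgt_cat /c; rewrite uK in uW.
change ((N%:Z)%:~R - ((maxw M * K)%:Z)%:~R <= (path_wgt h + path_wgt u)%:~R :> R).
rewrite -rmorphB ler_int; lia.
Qed.

(** The bound [c] on the negative part is fixed before [N], so it cannot cancel a large positive
    part. *)
Definition diverges s := exists c, forall N : R, exists S n0, forall n, (n0 <= n)%N ->
  pexp S [::] s n (at_goal goal (negw R)) <= c /\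
  N <= pexp S [::] s n (at_goal goal (posw R)).

(** Take [a], use the diverging scheduler at [t] and exploration at the other successors, whose
    negative part is bounded. *)
Lemma diverges_step s t : mdp_edge s t -> diverges t -> diverges s.
Proof.
move=> /existsP[a /andP[sa st]] [c dt].
have [C C0 CP] := explore_negw R hM.
have T0 : 0 < tprob R s a t by rewrite tprob_gt0.
exists ((maxw M)%:R + Num.max c C) => N.
(* The target is divided by the probability of [t] and raised by the largest loss in one step. *)
have [S [n0 Sn]] := dt (N / tprob R s a t + (maxw M)%:R).
pose Sf u := if u == t then S else explore.
exists (first_step s a Sf), n0.+1; case=> // n /Sn[nc Np].
rewrite !pexp_first_step//; split.
  apply: le_trans (_ : \sum_u tprob R s a u * ((maxw M)%:R + Num.max c C) <= _).
    apply: ler_sum => u _; rewrite ler_wpM2l ?tprob_ge0//.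
    apply: le_trans (_ : pexp (Sf u) [::] u n (fun h v => (maxw M)%:R +
        at_goal goal (negw R) h v) <= _).
      apply: pexp_le => h v; rewrite at_goal_cons /at_goal.
      case: (v == goal); rewrite ?mulr0 ?addr0// !mulr1.
      by apply: le_trans (negw_leD _ _ _) _; rewrite lerD2r norm_wgt_le.
    rewrite pexpD pexp_cst lerD2l /Sf; case: eqP => [->|_].
      by apply: le_trans nc _; rewrite le_max lexx.
    apply: le_trans (CP [::] u n _) _; first by rewrite path_wgt_nil.
    by rewrite le_max lexx orbT.
  by rewrite -mulr_suml tprob_sum// mul1r.
apply: le_trans (ler_sum1 t _); last first.
  move=> u; rewrite mulr_ge0 ?tprob_ge0// pexp_ge0// => h v.
  by apply: at_goal_ge0; exact: posw_ge0.
rewrite mulrC -ler_pdivrMr// /Sf eqxx.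
apply: (@le_trans _ _ (pexp S [::] t n (at_goal goal (posw R)) -
  (maxw M)%:R * pexp S [::] t n reached)).
  rewrite -lerBrDr in Np; apply: le_trans Np _.
  by rewrite lerD2l lerN2 -[leRHS]mulr1 ler_wpM2l// pexp_reached_le1.
rewrite -pexpZ -pexpN -pexpD; apply: pexp_le => h v.
rewrite at_goal_cons /at_goal; case: (v == goal); rewrite ?mulr0 ?subr0// !mulr1.
apply: le_trans (posw_geD _ _ _); by rewrite lerD2l lerN2 norm_wgt_le.
Qed.

Lemma diverges_reachable s t : reachable s t -> diverges t -> diverges s.
Proof.
move=> /connectP[p]; elim: p s => [|u p IHp] s /=; first by move=> _ ->.
by move=> /andP[su up] e dt; apply: diverges_step su _; exact: IHp e dt.
Qed.

(** The reaching probability is at most 1, so a positive part above [c + |N|] outweighs both the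
    negative part and [N] times that probability; it also forces that probability to be positive. *)
Lemma diverges_gains s (N : R) : diverges s -> gains goal s N.
Proof.
move=> [c ds]; have [S [n0 Sn]] := ds (c + `|N| + 1).
exists S, c, n0 => n /Sn[nc Np].
have n_ge0 : 0 <= pexp S [::] s n (at_goal goal (negw R)).
  by apply: pexp_ge0 => *; apply: at_goal_ge0; exact: negw_ge0.
have p0 := pexp_reached_ge0 goal S [::] s n.
have p1 := pexp_reached_le1 goal S [::] s n.
have N0 := normr_ge0 N.
split=> //.
  rewrite lt_neqAle p0 andbT; apply/eqP => /esym/(@pexp_reached0 _ _ _ _ _ _ _ (posw R)) E.
  by rewrite E in Np; lra.
rewrite pexp_at_goalB.
have : N * pexp S [::] s n reached <= `|N|.
  apply: le_trans (ler_norm _) _; rewrite normrM (ger0_norm p0).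
  by rewrite -[leRHS]mulr1 ler_wpM2l.
lra.
Qed.

(** In an absorbing state the weight stays 0 and never passes 1. A divergent component therefore
    avoids [goal] and [fail]. *)
Lemma divergent_not_absorbing S s :
  (forall n : nat, Pr S s (@ev_wgt_ge M n) = 1%E) -> ~ absorbing s.
Proof.
move=> PS sabs; have [k] := passed_half (PS 1%N).
suff -> : pexp S [::] s k (fun h _ => (passed 1 h)%:R) = 0 by lra.
rewrite -[RHS](pexp_cst S [::] s k).
apply: (@pexp_eq_inv _ _
  (fun h t => [/\ t = s, path_wgt h = 0 & ~~ passed 1 h])).
- move=> h t a t' [-> h0 hp] _ st'; have [-> w0] := absorbing_step sabs st'.
  split=> //; rewrite ?passed_rcons ?(negPf hp) path_wgt_rcons h0 w0//.
- by move=> h t [_ _ /negPf ->].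
- by split; rewrite ?path_wgt_nil ?passed_nil.
Qed.

(** * Following a divergent component up to a level, then exploring *)

Section divergent_component.
Variables (E : {set state M}) (A : state M -> {set action M}).
Hypothesis EA : end_component E A.
Variables (SE : scheduler R M) (SEA : scheduler_in E A SE).
Hypothesis SE1 : forall s, s \in E -> forall n : nat, Pr SE s (@ev_wgt_ge M n) = 1%E.

Let E_reach s : s \in E -> reachable s goal.
Proof.
move=> sE; apply/negPn/negP => /(fail_absorbing hM).
exact: divergent_not_absorbing (SE1 sE).
Qed.

Let E_goal : goal \notin E.
Proof. by apply/negP => /SE1/divergent_not_absorbing; apply. Qed.

Definition until_passed (N : int) : scheduler R M :=
  reroute (fun h _ => if passed N h then explore else SE) id.

Lemma until_passed_explore N h s n F : passed N h ->
  pexp (until_passed N) h s n F = pexp explore h s n F.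
Proof.
move=> Nh; apply: (@pexp_sim _ _ id (fun h _ => passed N h)) => //.
- by move=> h' s' a t Nh' _ _; rewrite passed_rcons Nh'.
- by move=> h' s' a Nh'; rewrite /= Nh'.
Qed.

Let E_step h s a t : s \in E -> 0 < SE h s a -> 0 < trans s a t -> t \in E.
Proof. by move=> sE /(SEA sE) aA; exact: ec_closed EA _ _ _ sE aA. Qed.

Let until_passedE N h s a : ~~ passed N h -> until_passed N h s a = SE h s a.
Proof. by rewrite /= => /negPf ->. Qed.

(** Before the level is passed the path stays in [E], away from [goal], and pays nothing; at the
    switch the weight is at least [N], hence nonnegative, and the bound for [explore] applies. *)
Lemma until_passed_negw (C : R) : 0 <= C ->
  (forall h s n, 0 <= path_wgt h ->
     pexp explore h s n (at_goal goal (negw R)) <= C) ->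
  forall N n h s, 0 <= N -> s \in E -> ~~ passed N h ->
  pexp (until_passed N) h s n (at_goal goal (negw R)) <= C.
Proof.
move=> C0 CP N n h s N0; elim: n h s=> [|n IHn] h s sE hN.
  rewrite /= /at_goal; have [sg|_] := eqVneq s goal; last by rewrite mulr0.
  by move: E_goal; rewrite -sg sE.
rewrite pexpS -(step_sum SE h s C); apply: ler_sum => a _.
rewrite until_passedE//; have := choice_ge0 SE h s a.
rewrite le_eqVlt => /predU1P[<-|Sa]; first by rewrite !mul0r.
rewrite ler_wpM2l ?choice_ge0//; apply: ler_sum => t _.
have := tprob_ge0 R s a t; rewrite le_eqVlt => /predU1P[<-|st].
  by rewrite !mul0r.
rewrite ler_wpM2l ?tprob_ge0//.
have [hN1|hN1] := boolP (passed N (rcons h (s, a))).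
  rewrite until_passed_explore// CP//.
  by move: hN1; rewrite passed_rcons (negPf hN) /=; apply: le_trans.
by apply: IHn => //; apply: E_step sE Sa _; rewrite -(tprob_gt0 R).
Qed.

(** The [K] additional steps leave enough time to explore even when the level is passed only at step
    [j]. *)
Lemma until_passed_posw (N : int) K (c : R) : 0 <= c ->
  (forall h s n, reachable s goal -> (K <= n)%N -> N <= path_wgt h ->
     c <= pexp explore h s n (at_goal goal (posw R))) ->
  forall j h s, s \in E -> ~~ passed N h ->
  c * pexp SE h s j (fun h' _ => (passed N h')%:R) <=
  pexp (until_passed N) h s (j + K) (at_goal goal (posw R)).
Proof.
move=> c0 cP; elim=> [|j IHj] h s sE hN.
  rewrite /= (negPf hN) mulr0; apply: pexp_ge0 => *.
  by apply: at_goal_ge0; exact: posw_ge0.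
rewrite addSn !pexpS mulr_sumr; apply: ler_sum => a _.
rewrite until_passedE// mulrCA; have := choice_ge0 SE h s a.
rewrite le_eqVlt => /predU1P[<-|Sa]; first by rewrite !mul0r.
rewrite ler_wpM2l ?choice_ge0// mulr_sumr; apply: ler_sum => t _.
rewrite mulrCA; have := tprob_ge0 R s a t; rewrite le_eqVlt => /predU1P[<-|st].
  by rewrite !mul0r.
have tE : t \in E by apply: E_step sE Sa _; rewrite -(tprob_gt0 R).
rewrite ler_wpM2l ?tprob_ge0//.
have [hN1|hN1] := boolP (passed N (rcons h (s, a))); last exact: IHj.
rewrite until_passed_explore//; apply: (@le_trans _ _ c).
  rewrite -[leRHS]mulr1 ler_wpM2l// -[leRHS](pexp_cst SE (rcons h (s, a)) t j).
  by apply: pexp_le => *; case: (passed _ _).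
apply: cP; [exact: E_reach|exact: leq_addl|].
by move: hN1; rewrite passed_rcons (negPf hN).
Qed.

Lemma component_diverges s : s \in E -> diverges s.
Proof.
move=> sE; have [C C0 CP] := explore_negw R hM.
have [K [q q0 qP]] := explore_posw.
(* The level covers the loss [maxw M * K] during exploration and leaves enough that, after the
   factors [q] and [1/2], at least [|X|] remains. *)
exists C => X; pose N := (maxw M * K + (Num.bound (`|X| / q * 2)).+1)%N.
have [k kN] := passed_half (SE1 sE N).
have N0 : ~~ passed N [::] by rewrite passed_nil; rewrite /N; lia.
exists (until_passed N), (k + K)%N => n kn; split.
  exact: until_passed_negw.
pose c := (N%:R - (maxw M * K)%:R) * q.
have bX : `|X| / q * 2 <= N%:R - (maxw M * K)%:R.
  have : `|X| / q * 2 < (Num.bound (`|X| / q * 2))%:R.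
    by apply: archi_boundP; rewrite !mulr_ge0// invr_ge0 ltW.
  by rewrite /N natrD -[(Num.bound _).+1]addn1 natrD; lra.
have c0 : 0 <= c.
  apply: mulr_ge0; last exact: ltW.
  by apply: le_trans bX; rewrite !mulr_ge0// invr_ge0 ltW.
have Xc : `|X| <= c * 2^-1.
  have : `|X| / q * 2 * q <= c by rewrite ler_wpM2r// ltW.
  rewrite mulrAC divfK ?gt_eqF//; lra.
apply: le_trans (ler_norm X) _; apply: le_trans Xc _.
apply: le_trans (_ : c * pexp SE [::] s k (fun h' _ => (passed N h')%:R) <= _).
  by rewrite ler_wpM2l.
apply: le_trans (pexp_at_goal_mono goal_abs _ _ _ _ kn); last exact: posw_ge0.
by apply: until_passed_posw => // h t m tg Km Nh; exact: qP.
Qed.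

End divergent_component.

Lemma divergent_gains (E : {set state M}) (A : state M -> {set action M}) :
  end_component E A -> pos_wgt_divergent R E A -> forall N : R, gains goal (s_init M) N.
Proof.
move=> EA [SE SEA SE1] N; have /set0Pn[s sE] := ec_nonempty EA.
apply: diverges_gains; apply: (@diverges_reachable _ s).
  exact: (all_reachable hM).
exact: component_diverges EA SE SEA SE1 s sE.
Qed.

End weight_divergence.

(** * Maximal probability of gaining weight *)

Section weight_value.
Variables (R : realType) (M : mdp).
Implicit Types (S : scheduler R M) (h : seq (letter M)) (s t u : state M).
Implicit Types (a : action M) (A : state M -> {set action M}) (N : int).

Local Notation W := (maxw M).

(* The maximal probability of accumulating weight at least [N] within [k] steps,
   using only actions of [A]. *)
Fixpoint value A k s N : R :=
  if N <= 0 then 1 else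
  if k is k'.+1 then
    \big[Num.max/0]_(a in A s) \sum_t tprob R s a t * value A k' t (N - wgt s a)
  else 0.

Lemma value_le0 A k s N : N <= 0 -> value A k s N = 1.
Proof. by case: k => [|k] /= ->. Qed.

Lemma value0 A s N : 0 < N -> value A 0 s N = 0.
Proof. by move=> N0; rewrite /= leNgt N0. Qed.

Lemma valueS A k s N : 0 < N -> value A k.+1 s N =
  \big[Num.max/0]_(a in A s) \sum_t tprob R s a t * value A k t (N - wgt s a).
Proof. by move=> N0; rewrite /= leNgt N0. Qed.

Lemma step_le s a (f g : state M -> R) :
  (forall t, 0 < trans s a t -> f t <= g t) ->
  \sum_t tprob R s a t * f t <= \sum_t tprob R s a t * g t.
Proof.
move=> fg; apply: ler_sum => t _; have := tprob_ge0 R s a t.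
rewrite le_eqVlt => /predU1P[<-|st]; first by rewrite !mul0r.
by rewrite ler_pM2l// fg// -(tprob_gt0 R).
Qed.

Lemma step_cst s a (c : R) : enabled s a -> \sum_t tprob R s a t * c = c.
Proof. by move=> sa; rewrite -mulr_suml tprob_sum// mul1r. Qed.

Lemma value_ge0 A k s N : 0 <= value A k s N.
Proof.
have [N0|N0] := leP N 0; first by rewrite value_le0.
by case: k => [|k]; [rewrite value0|rewrite valueS// bigmax_idl le_max lexx].
Qed.

Lemma value_action A k s N a : 0 < N -> a \in A s ->
  \sum_t tprob R s a t * value A k t (N - wgt s a) <= value A k.+1 s N.
Proof. by move=> N0 aA; rewrite valueS//; exact: le_bigmax_cond. Qed.

Lemma valueS_le A k s N (c : R) : 0 < N -> 0 <= c ->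
  (forall a, a \in A s ->
     \sum_t tprob R s a t * value A k t (N - wgt s a) <= c) ->
  value A k.+1 s N <= c.
Proof. by move=> N0 c0 Ac; rewrite valueS//; exact: bigmax_le. Qed.

Lemma value_argmax A k s N : 0 < N -> A s != finset.set0 ->
  exists2 a, a \in A s &
    value A k.+1 s N = \sum_t tprob R s a t * value A k t (N - wgt s a).
Proof.
move=> N0 /set0Pn[b bA]; rewrite valueS//.
pose f a := \sum_t tprob R s a t * value A k t (N - wgt s a).
have f0 a : a \in A s -> 0 <= f a.
  by move=> _; apply: sumr_ge0 => t _; rewrite mulr_ge0 ?tprob_ge0 ?value_ge0.
by have [a aA ->] := eq_bigmax b (mem (A s)) f bA f0; exists a.
Qed.

Lemma value_mono A k l s N : (k <= l)%N -> value A k s N <= value A l s N.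
Proof.
elim: k l s N => [|k IHk] l s N kl.
  have [N0|N0] := leP N 0; first by rewrite !value_le0.
  by rewrite value0// value_ge0.
case: l kl => // l kl; have [N0|N0] := leP N 0; first by rewrite !value_le0.
apply: valueS_le => [//||a aA]; first exact: value_ge0.
by apply: le_trans (value_action _ N0 aA); apply: step_le => t _; exact: IHk.
Qed.

Section enabled_actions.
Variable A : state M -> {set action M}.
Hypothesis A_enabled : forall s a, a \in A s -> enabled s a.

Lemma value_le1 k s N : value A k s N <= 1.
Proof.
elim: k s N => [|k IHk] s N; have [N0|N0] := leP N 0;
  rewrite ?(value_le0 _ _ _ N0)//.
  by rewrite value0.
apply: valueS_le => // a /A_enabled sa.
by rewrite -[leRHS](step_cst 1 sa); apply: step_le.
Qed.

Lemma value_anti k s N N' : N <= N' -> value A k s N' <= value A k s N.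
Proof.
elim: k s N N' => [|k IHk] s N N' NN'; have [N0|N0] := leP N 0;
  rewrite ?(value_le0 _ _ _ N0) ?value_le1//.
  by rewrite !value0// (lt_le_trans N0).
apply: valueS_le => [||a aA]; rewrite ?value_ge0 ?(lt_le_trans N0)//.
by apply: le_trans (value_action _ N0 aA); apply: step_le => t _; apply: IHk; lia.
Qed.

(* A path gaining [L + N + W] first passes the level [L], overshooting it by at
   most [W], and then gains [N]. *)
Lemma value_split k s L N (c : R) : 0 <= N -> - W%:Z <= L ->
  (forall j t, value A j t N <= c) ->
  value A k s (L + N + W%:Z) <= value A k s L * c.
Proof.
move=> N0 LW cP; have c0 : 0 <= c := le_trans (value_ge0 A 0 s N) (cP 0%N s).
elim: k s L LW => [|k IHk] s L LW; have [L0|L0] := leP L 0.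
(* The level [L] is already reached, and [- W <= L] means that at least [N] is still missing. The
   lower bound on [L] is what overshooting by one step can produce. *)
- by rewrite [in leRHS]value_le0// mul1r; apply: le_trans (cP 0%N s); apply: value_anti; lia.
- by rewrite !value0 ?mul0r//; lia.
- by rewrite [in leRHS]value_le0// mul1r; apply: le_trans (cP k.+1 s); apply: value_anti; lia.
apply: valueS_le => [||a aA]; first by lia.
  by rewrite mulr_ge0// value_ge0.
apply: le_trans (_ : (\sum_t tprob R s a t * value A k t (L - wgt s a)) * c <= _).
  rewrite mulr_suml; apply: ler_sum => t _; rewrite -mulrA ler_wpM2l ?tprob_ge0//.
  rewrite (_ : _ - wgt s a = L - wgt s a + N + W%:Z); last by lia.
  by apply: IHk; have := wgt_le s a; lia.
by rewrite ler_wpM2r// value_action.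
Qed.

End enabled_actions.

Definition all_enabled s : {set action M} := [set a | enabled s a]%SET.

Lemma all_enabledP s a : a \in all_enabled s -> enabled s a.
Proof. by rewrite inE. Qed.

(** A randomized choice is an average over enabled actions, so no history-dependent scheduler
    exceeds the maximum. *)
Lemma pexp_le_value S h s k N :
  pexp S h s k (fun h' _ => (path_wgt h + N <= path_wgt h')%R%:R) <=
  value all_enabled k s N.
Proof.
elim: k h s N => [|k IHk] h s N; have [N0|N0] := leP N 0.
- by rewrite value_le0//= lern1 leq_b1.
- rewrite value0//=; suff -> : (path_wgt h + N <= path_wgt h) = false by [].
  by lia.
- rewrite value_le0// -[leRHS](pexp_cst S h s k.+1); apply: pexp_le => h' _.
  by rewrite lern1 leq_b1.
rewrite pexpS -[leRHS](step_sum S h s); apply: ler_sum => a _.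
have := choice_ge0 S h s a; rewrite le_eqVlt => /predU1P[<-|Sa].
  by rewrite !mul0r.
have sa := choice_enabled Sa; rewrite ler_pM2l// step_cst//.
apply: le_trans (@value_action _ k s N a N0 _); last by rewrite inE.
apply: step_le => t _; apply: le_trans (IHk _ t _).
apply: pexp_le => h' _; rewrite path_wgt_rcons /=.
by rewrite (_ : path_wgt h + _ + _ = path_wgt h + N)//; lia.
Qed.

(** A layer decomposition: [x] is covered by blocks of length [b], one for each multiple of [b] not
    above it. *)
Lemma posw_layers (b : nat) (x : int) J : x <= (J * b)%N%:Z ->
  posw R x <= b%:R * \sum_(j < J) ((j * b)%N%:Z <= x)%R%:R.
Proof.
elim: J => [|J IHJ] xJ.
  by rewrite big_ord0 mulr0 ge_max lexx andbT lerz0.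
rewrite big_ord_recr /= mulrDr.
have [xb|/ltW bx] := leP x (J * b)%N%:Z.
  by apply: le_trans (IHJ xb) _; rewrite lerDl mulr_ge0.
rewrite bx (eq_bigr (fun=> 1)) => [|j _]; last first.
  suff -> : (j * b)%N%:Z <= x by [].
  by apply: le_trans bx; rewrite lez_nat leq_mul2r ltnW ?orbT.
rewrite sumr_const card_ord -mulrDr -natrD -natrM addn1 mulnC ge_max ler0n andbT.
by change (x%:~R <= ((J.+1 * b)%N%:Z)%:~R :> R); rewrite ler_int.
Qed.

(** * Geometric tails when no state gains the level [L] with probability above [1 - q] *)

Section bounded_gain.
Variables (L : nat) (q : R).
Hypotheses (q0 : 0 < q) (L0 : (0 < L)%N).
Hypothesis valueL : forall k s, value all_enabled k s L%:Z <= 1 - q.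

Lemma value_geometric j k s :
  value all_enabled k s (j * (L + W))%N%:Z <= (1 - q) ^+ j.
Proof.
elim: j k s => [|j IHj] k s; first by rewrite expr0 value_le1//; exact: all_enabledP.
rewrite (_ : (j.+1 * _)%N%:Z = L%:Z + (j * (L + W))%N%:Z + W%:Z); last by lia.
have := @value_split _ all_enabledP k s L%:Z _ _ _ _ (fun k' s' => IHj k' s').
move=> /(_ isT) => /(_ ltac:(lia))/le_trans; apply.
rewrite exprS ler_wpM2r// exprn_ge0//.
exact: le_trans (value_ge0 _ 0 s L%:Z) (valueL 0 s).
Qed.

Lemma pexp_posw_bounded S h s k :
  pexp S h s k (fun h' _ => posw R (path_wgt h' - path_wgt h)) <= (L + W)%:R / q.
Proof.
(* A path of [k] steps gains at most [W * k], so [J] layers suffice. *)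
pose b := (L + W)%N; pose J := (W * k).+1.
apply: le_trans (_ : pexp S h s k (fun h' _ =>
  b%:R * \sum_(j < J) ((j * b)%N%:Z <= path_wgt h' - path_wgt h)%R%:R) <= _).
  apply: pexp_le_cat => u _ uk; apply: posw_layers.
  rewrite path_wgt_cat addrAC subrr add0r.
  apply: le_trans (path_wgt_le u) _; rewrite uk lez_nat /J /b.
  apply: leq_trans (leqnSn _) _; rewrite leq_pmulr//.
  by rewrite addn_gt0 L0.
rewrite pexpZ ler_wpM2l// pexp_sum.
apply: le_trans (_ : \sum_(j < J) (1 - q) ^+ j <= _).
  apply: ler_sum => j _; apply: le_trans (@value_geometric j k s).
  apply: le_trans (pexp_le_value S h s k _); apply: pexp_le => h' _.
  by rewrite lerBrDl.
rewrite -[q^-1]mul1r ler_pdivlMr// mulrC.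
have := subrX1 (1 - q) J; rewrite addrAC subrr add0r mulNr => /eqP.
have : 0 <= (1 - q) ^+ J.
  by rewrite exprn_ge0// (le_trans (value_ge0 all_enabled 0 s L%:Z)).
move: (_ ^+ J) (q * _) => x y; lra.
Qed.

End bounded_gain.

End weight_value.

(** * A divergent end component from almost sure gains *)

Section sure_gain.
Variables (R : realType) (M : mdp).
Implicit Types (S : scheduler R M) (h : seq (letter M)) (s t u : state M).
Implicit Types (a : action M) (N : int).

Local Notation W := (maxw M).
Local Notation value := (@value R M).
Local Notation all_enabled := (@all_enabled M).

Definition sure s := forall N (e : R), 0 < e ->
  exists k, 1 - e < value all_enabled k s N.

Definition sures : {set state M} := [set s | `[< sure s >]]%SET.

Lemma suresP s : reflect (sure s) (s \in sures).
Proof. by rewrite inE; exact: asboolP. Qed.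

Lemma unsure_uniform : exists L : nat, exists2 q : R, 0 < q & forall s, s \notin sures ->
  forall k N, L%:Z <= N -> value all_enabled k s N <= 1 - q.
Proof.
pose Q s (L : nat) q := s \notin sures ->
  forall k N, L%:Z <= N -> value all_enabled k s N <= 1 - q.
have [L] : exists L, forall s, exists2 q : R, 0 < q & Q s L q.
  apply: fin_uniform_nat => [s m n mn [q q0 qm]|s].
    by exists q => // sN k N nN; apply: qm => //; apply: le_trans nN.
  have [sS|] := boolP (s \in sures); first by exists 0%N, 1 => // /negP.
  move=> /suresP /existsNP[N] /existsNP[e] /not_implyP[e0 /forallNP ne].
  exists `|N|%N, e => // _ k N' NN'; apply: (@le_trans _ _ (value all_enabled k s N)).
    by apply: value_anti => [//|]; [exact: all_enabledP|lia].
  by rewrite leNgt; apply/negP; exact: ne.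
move=> /fin_uniform_real[s p q p0 pq Qq /Qq sq k N /sq/le_trans|q q0 Qq].
  by apply; rewrite lerD2l lerN2.
by exists L, q.
Qed.

Definition sure_actions s : {set action M} :=
  [set a | enabled s a & [forall t, (0 < trans s a t) ==> (t \in sures)]]%SET.

Lemma sure_actionsP s a : reflect
  (enabled s a /\ forall t, 0 < trans s a t -> t \in sures) (a \in sure_actions s).
Proof.
rewrite inE; apply: (iffP andP) => -[sa sS]; split=> //.
  by move=> t st; have /forallP/(_ t)/implyP := sS; apply.
by apply/forallP => t; apply/implyP; exact: sS.
Qed.

Lemma sure_actions_enabled s a : a \in sure_actions s -> enabled s a.
Proof. by case/sure_actionsP. Qed.

(** An action that is not sure reaches some unsure state, with at least the smallest positive
    transition probability [p]; there the failure probability is at least [q]. The extra [W] in the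
    level absorbs the weight of the action. *)
Lemma unsure_action : exists L : nat, exists2 d : R, 0 < d <= 1 & forall s a k N,
  enabled s a -> a \notin sure_actions s -> L%:Z <= N ->
  \sum_t tprob R s a t * value all_enabled k t (N - wgt s a) <= 1 - d.
Proof.
have [L [q q0 qP]] := unsure_uniform.
have [p p0 pP] : exists2 p : R, 0 < p & forall x : state M * action M * state M,
    0 < trans x.1.1 x.1.2 x.2 -> p <= tprob R x.1.1 x.1.2 x.2.
  apply: fin_uniform_real => [x p p' _ pp' xp /xp|[[s a] t]].
    exact: le_trans.
  have [st|st] := boolP (0 < trans s a t); last by exists 1 => // /(negP st).
  by exists (tprob R s a t); rewrite ?tprob_gt0.
exists (L + W)%N, (Num.min 1 (p * q)).
  by rewrite lt_min ltr01 mulr_gt0//= ge_min lexx.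
move=> s a k N sa aA LN.
have [t st tS] : exists2 t, 0 < trans s a t & t \notin sures.
  apply/not_exists2P => none; move/sure_actionsP: aA; apply; split=> // t st.
  by apply/negPn/negP => tS; have [] := none t.
apply: (@le_trans _ _ (\sum_u tprob R s a u * (1 - (u == t)%:R * q))).
  apply: step_le => u su; have [->|_] := eqVneq u t.
    by rewrite mul1r; apply: qP => //; have := wgt_le s a; lia.
  by rewrite mul0r subr0 value_le1//; exact: all_enabledP.
under eq_bigr do rewrite mulrBr mulr1.
rewrite sumrB tprob_sum// lerD2l lerN2 (bigD1 t)//= eqxx mul1r big1 ?addr0.
  by rewrite ge_min ler_pM2r// (pP (s, a, t))// orbT.
by move=> u /negPf ->; rewrite mul0r mulr0.
Qed.

(** If every enabled action could leave the sure states, the value at level [L + 1] would be at most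
    [1 - d] for all horizons. *)
Lemma sure_actions_neq0 s : s \in sures -> sure_actions s != finset.set0.
Proof.
move=> /suresP sS; apply/negP => /eqP A0.
have [L [d /andP[d0 d1] dP]] := unsure_action.
have [k] := sS (L%:Z + 1) _ d0; rewrite ltNge => /negP; apply.
apply: le_trans (@value_mono R M _ k k.+1 s _ (leqnSn k)) _.
apply: valueS_le => [||a]; [lia|by rewrite subr_ge0|rewrite inE => sa].
by apply: dP => //; [rewrite A0 inE|lia].
Qed.

(* Leaving the sure states costs probability at least [d], so a strategy that
   almost surely gains enough must stay among them. *)
Lemma value_sure_actions : exists L : nat, exists2 d : R, 0 < d <= 1 &
  forall k s N, s \in sures ->
  d * (1 - value sure_actions k s N) <= 1 - value all_enabled k s (N + L%:Z).
Proof.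
have [L [d /andP[d0 d1] dP]] := unsure_action.
exists (L + W)%N, d; rewrite ?d0// => k s N.
elim: k s N => [|k IHk] s N sS; have [N0|N0] := leP N 0.
- rewrite [value sure_actions _ _ _]value_le0// subrr mulr0 subr_ge0.
  exact/value_le1/all_enabledP.
- by rewrite !value0//; [rewrite !subr0 mulr1|lia].
- rewrite [value sure_actions _ _ _]value_le0// subrr mulr0 subr_ge0.
  exact/value_le1/all_enabledP.
have main : value all_enabled k.+1 s (N + (L + W)%N%:Z) <=
    1 - d * (1 - value sure_actions k.+1 s N).
  apply: valueS_le => [||a]; first by lia.
    rewrite subr_ge0 mulr_ile1//; first exact: ltW.
      by rewrite subr_ge0 value_le1//; exact: sure_actions_enabled.
    by rewrite gerBl value_ge0.
  rewrite inE => sa; have [aA|aA] := boolP (a \in sure_actions s).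
    (* For an action that stays, the affine bound at the successors is averaged. *)
    apply: (@le_trans _ _ (\sum_t tprob R s a t *
        (1 - d * (1 - value sure_actions k t (N - wgt s a))))).
      apply: step_le => t st; rewrite lerBrDl -lerBrDr.
      have [_ /(_ t st) tS] := sure_actionsP _ _ aA.
      by rewrite addrAC; exact: IHk.
    have -> : \sum_t tprob R s a t *
        (1 - d * (1 - value sure_actions k t (N - wgt s a))) =
        1 - d * (1 - \sum_t tprob R s a t * value sure_actions k t (N - wgt s a)).
      under eq_bigr do rewrite mulrBr mulr1 mulrCA mulrBr mulr1.
      by rewrite sumrB tprob_sum// -mulr_sumr sumrB tprob_sum.
    rewrite lerD2l lerN2 ler_wpM2l ?(ltW d0)// lerD2l lerN2.
    exact: value_action.
  (* An action that may leave already fails with probability at least [d]. *)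
  apply: le_trans (dP s a k _ sa aA _) _; first by lia.
  rewrite lerD2l lerN2 -[leRHS]mulr1 ler_wpM2l ?(ltW d0)//.
  by rewrite gerBl value_ge0.
lra.
Qed.

(** Sureness with error [d / 2] leaves failure probability at most [1/2] after dividing by [d]. The
    horizon is a successor so that each round below has at least one step. *)
Lemma value_half : forall N, exists k, forall s, s \in sures ->
  2^-1 <= value sure_actions k.+1 s N.
Proof.
move=> N; apply: fin_uniform_nat => [s m n mn mP /mP/le_trans|s].
  by apply; exact: value_mono.
have [sS|] := boolP (s \in sures); last by exists 0%N.
have [L [d /andP[d0 d1] dP]] := value_sure_actions.
have d20 : 0 < d * 2^-1 by rewrite mulr_gt0.
have [k kP] := suresP _ sS (N + L%:Z) _ d20; exists k => _.
apply: le_trans (@value_mono R M _ k k.+1 s _ (leqnSn k)).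
have : d * (1 - value sure_actions k s N) <= d * 2^-1.
  by apply: le_trans (dP k s N sS) _; lra.
by rewrite ler_pM2l//; lra.
Qed.

Definition horizon N : nat := sval (cid (value_half N)).

Lemma horizonP N s : s \in sures ->
  2^-1 <= value sure_actions (horizon N).+1 s N.
Proof. exact: (svalP (cid (value_half N))). Qed.

(* The steps are grouped in rounds: [clock j = (i, r)] means that step [j]
   belongs to round [i], which has [r] further steps.  Round [i] tries to reach
   the level [i] from any weight possible at its beginning. *)
Fixpoint clock j : nat * nat :=
  if j is j'.+1 then
    let: (i, r) := clock j' in
    if r is r'.+1 then (i, r') else (i.+1, horizon (i.+1 + W * j'.+1)%N%:Z)
  else (0%N, horizon 0).

Lemma clock_round j i r : clock j = (i, r) ->
  clock (j + r.+1) = (i.+1, horizon (i.+1 + W * (j + r.+1))%N%:Z).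
Proof.
elim: r j => [|r IHr] j ji; first by rewrite addn1 /= ji.
by rewrite -addSnnS (IHr j.+1) ?addSnnS//= ji.
Qed.

Lemma clock_ex i : exists j r, clock j = (i, r).
Proof.
elim: i => [|i [j [r ji]]]; first by exists 0%N, (horizon 0).
by exists (j + r.+1)%N, (horizon (i.+1 + W * (j + r.+1))%N%:Z); exact: clock_round.
Qed.

(** Below the level of the current round only actions optimal for the remaining steps are kept;
    above it any action staying among the sure states will do. *)
Definition climb_actions h s : {set action M} :=
  let: (i, r) := clock (size h) in
  let N := i%:Z - path_wgt h in
  if 0 < N then
    [set a in sure_actions s | \sum_t tprob R s a t *
      value sure_actions r t (N - wgt s a) == value sure_actions r.+1 s N]%SET
  else sure_actions s.

Definition climb : scheduler R M := uniform R climb_actions.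

Lemma climb_actionsP h s a : s \in sures -> 0 < climb h s a ->
  [/\ enabled s a, a \in sure_actions s & forall i r, clock (size h) = (i, r) ->
     0 < i%:Z - path_wgt h ->
     \sum_t tprob R s a t *
       value sure_actions r t (i%:Z - path_wgt h - wgt s a) =
     value sure_actions r.+1 s (i%:Z - path_wgt h)].
Proof.
move=> sS; rewrite uniform_gt0 effectiveE; last first.
  rewrite /climb_actions; case: (clock _) => i r; case: ltP => N0.
    have [b bA bE] := value_argmax R r N0 (sure_actions_neq0 sS).
    exists b; last exact: sure_actions_enabled.
    by rewrite inE bA bE eqxx.
  have /set0Pn[b bA] := sure_actions_neq0 sS.
  by exists b => //; exact: sure_actions_enabled.
rewrite /climb_actions; case: (clock _) => i r; case: ltP => N0.
  rewrite inE => /andP[/andP[aA /eqP aE] sa]; split=> // _ _ [<- <-] _.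
  exact: aE.
by move=> /andP[aA sa]; split=> // _ _ [<- <-]; rewrite ltNge N0.
Qed.

Lemma climb_sures h s a t : s \in sures -> 0 < climb h s a -> 0 < trans s a t ->
  t \in sures.
Proof. by move=> sS /(climb_actionsP sS)[_ /sure_actionsP[_ sa] _]; exact: sa. Qed.

(** * The climbing scheduler passes a fixed level almost surely *)

Section level.
Variable n0 : nat.

Local Notation missed := (fun h _ => (~~ passed n0 h)%:R : R).

Lemma pexp_missed_passed S h s n : passed n0 h -> pexp S h s n missed = 0.
Proof.
move=> hp; rewrite -[RHS](pexp_cst S h s n).
apply: (@pexp_eq_inv _ _ (fun h _ => passed n0 h)) => //.
  by move=> h' s' a t hp' _ _; rewrite passed_rcons hp'.
by move=> h' s' ->.
Qed.

Lemma pexp_missed_le1 S h s n : pexp S h s n missed <= 1.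
Proof.
rewrite -[leRHS](pexp_cst S h s n); apply: pexp_le => h' _.
by case: (passed _ _).
Qed.

(** Optimal choices attain the value. Nothing is asked of the clock when [r = 0], since it has then
    moved on to the next round. *)
Lemma pexp_missed_round i r h s : (n0 <= i)%N -> s \in sures ->
  (forall r', r = r'.+1 -> clock (size h) = (i, r')) ->
  pexp climb h s r missed <= 1 - value sure_actions r s (i%:Z - path_wgt h).
Proof.
move=> n0i; elim: r h s => [|r IHr] h s sS hr.
  have [N0|N0] := leP (i%:Z - path_wgt h) 0.
    by rewrite value_le0// subrr pexp_missed_passed//; apply: passed_wgt; lia.
  by rewrite value0// subr0 pexp_missed_le1.
have [N0|N0] := leP (i%:Z - path_wgt h) 0.
  by rewrite value_le0// subrr pexp_missed_passed//; apply: passed_wgt; lia.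
rewrite pexpS -[leRHS](step_sum climb h s); apply: ler_sum => a _.
have := choice_ge0 climb h s a; rewrite le_eqVlt => /predU1P[<-|Sa].
  by rewrite !mul0r.
have hr' := hr r erefl; rewrite ler_pM2l//.
have [sa aA aE] := climb_actionsP sS Sa; rewrite -(aE i r)//.
apply: (@le_trans _ _ (\sum_t tprob R s a t *
   (1 - value sure_actions r t (i%:Z - path_wgt h - wgt s a)))).
  apply: step_le => t st.
  rewrite (_ : _ - wgt s a = i%:Z - path_wgt (rcons h (s, a))); last first.
    by rewrite path_wgt_rcons /=; lia.
  apply: IHr; first exact: climb_sures sS Sa st.
  by move=> r' rr'; rewrite size_rcons /= hr' rr'.
under eq_bigr do rewrite mulrBr mulr1.
by rewrite sumrB step_cst// tprob_sum.
Qed.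

(** Each further round halves the probability of a miss, whatever happened before it. *)
Lemma pexp_missed_rounds m j i r : clock j = (i, r) -> (n0 <= i)%N ->
  exists n, forall h s, size h = j -> s \in sures ->
  pexp climb h s n missed <=
    (1 - value sure_actions r.+1 s (i%:Z - path_wgt h)) * 2^-1 ^+ m.
Proof.
elim: m j i r => [|m IHm] j i r ji n0i.
  exists r.+1 => h s hj sS; rewrite expr0 mulr1; apply: pexp_missed_round => //.
  by move=> r' [<-]; rewrite hj.
have [n nP] := IHm _ _ _ (clock_round ji) (leqW n0i).
exists (r.+1 + n)%N => h s hj sS; rewrite pexp_cat.
apply: (@le_trans _ _ (pexp climb h s r.+1 (fun h' s' =>
    2^-1 ^+ m.+1 * missed h' s'))); last first.
  rewrite pexpZ mulrC ler_wpM2r ?exprn_ge0 ?invr_ge0//.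
  by apply: pexp_missed_round => // r' [<-]; rewrite hj.
apply: (@pexp_le_supp _ _ (fun _ s' => s' \in sures)) => //.
  by move=> h' s' a t; exact: climb_sures.
move=> u s' ur s'S; have [hp|hp] := boolP (passed n0 (h ++ u)).
  by rewrite pexp_missed_passed// mulr0.
rewrite mulr1; have hu : size (h ++ u) = (j + r.+1)%N by rewrite size_cat hj ur.
apply: le_trans (nP _ _ hu s'S) _.
rewrite exprS ler_wpM2r ?exprn_ge0 ?invr_ge0//.
(* After [j + r.+1] steps the weight is at least [- W * (j + r.+1)], so the gain for which the
   horizon was chosen covers the level [i.+1]. *)
have := @horizonP (i.+1 + W * (j + r.+1))%N%:Z s' s'S.
set H := horizon _ => H1; have H2 : value sure_actions H.+1 s' (i.+1 + W * (j + r.+1))%N%:Z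
  <= value sure_actions H.+1 s' (i.+1%:Z - path_wgt (h ++ u)).
  apply: value_anti; first exact: sure_actions_enabled.
  by have := path_wgt_ge (h ++ u); rewrite hu; lia.
lra.
Qed.

Lemma climb_missed m s : s \in sures ->
  exists n, pexp climb [::] s n missed <= 2^-1 ^+ m.
Proof.
move=> sS; have [j [r ji]] := clock_ex n0.
have [n nP] := pexp_missed_rounds m ji (leqnn _).
exists (j + n)%N; rewrite pexp_cat -[leRHS](pexp_cst climb [::] s j).
apply: (@pexp_le_supp _ _ (fun _ s' => s' \in sures)) => //.
  by move=> h' s' a t; exact: climb_sures.
move=> u s' uj s'S; apply: le_trans (nP _ _ uj s'S) _.
rewrite -[leRHS]mul1r ler_wpM2r ?exprn_ge0 ?invr_ge0//.
by rewrite gerBl value_ge0.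
Qed.

Lemma climb_sure s : s \in sures -> Pr climb s (@ev_wgt_ge M n0) = 1%E.
Proof.
move=> sS; apply/eqP; rewrite eq_le; apply/andP; split.
  by apply: probability_le1; exact: measurable_ev_wgt_ge.
apply/lee_addgt0Pr => e e0; rewrite -leeBlDr//.
have [m me] : exists m, (2^-1 : R) ^+ m <= e.
  have ei0 : 0 <= e^-1 by rewrite invr_ge0 ltW.
  exists (Num.bound e^-1).
  rewrite exprVn -[leRHS]invrK lef_pV2 ?posrE ?invr_gt0 ?exprn_gt0//.
  apply: le_trans (ltW (archi_boundP ei0)) _.
  by rewrite -natrX ler_nat ltnW// ltn_expl.
have [n nP] := climb_missed m sS.
apply: (cvge_ge _ (@cvg_passed R M climb s n0)); exists n => // k /= nk.
rewrite -EFinB lee_fin.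
have -> : pexp climb [::] s k (fun h _ => (passed n0 h)%:R) =
    1 - pexp climb [::] s k missed.
  rewrite -[X in X - _](pexp_cst climb [::] s k) -pexpN -pexpD; apply: eq_pexp => h _.
  by case: (passed _ _); rewrite /= ?subr0 ?subrr.
rewrite lerD2l lerN2; apply: le_trans me; apply: le_trans nP.
rewrite -(subnKC nk) pexp_cat; apply: pexp_le => h s'.
have [hp|hp] := boolP (passed n0 h); first by rewrite pexp_missed_passed.
exact: pexp_missed_le1.
Qed.

End level.

Let step_rel (X : {set state M}) := [rel x y | (x \in X) &&
  [exists a in sure_actions x, 0 < trans x a y]].

(** A bottom component of the graph of sure actions is closed under all of them, so [climb] started
    there never leaves it. *)
Lemma sure_divergent_component : sures != finset.set0 ->
  exists (E : {set state M}) (A : state M -> {set action M}),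
    end_component E A /\ pos_wgt_divergent R E A.
Proof.
move=> /set0Pn[s1 s1S]; pose reach s := [set t | connect (step_rel sures) s t]%SET.
(* A reachable set of minimal size is strongly connected. *)
have [s sS smin] : exists2 s, s \in sures & forall t, t \in sures ->
    (#|reach s| <= #|reach t|)%N.
  by case: (arg_minnP (fun s => #|reach s|) s1S) => s sS smin; exists s.
have reachS x y : x \in sures -> y \in reach x -> y \in sures.
  move=> xS; rewrite inE => /connectP[p]; elim: p x xS => [|z p IHp] x xS /=.
    by move=> _ ->.
  move=> /andP[/andP[_ /existsP[a /andP[/sure_actionsP[_ xz] /xz zS]]]].
  exact: IHp.
have reach_eq t : t \in reach s -> reach t = reach s.
  move=> ts; have sub : reach t \subset reach s.
    apply/fintype.subsetP => u; move: ts; rewrite ![_ \in reach _]inE => st tu.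
    exact: connect_trans st tu.
  apply/eqP; rewrite eqEcard sub; apply: smin.
  exact: (reachS s).
exists (reach s), sure_actions; split; last first.
  exists climb; last by move=> t ts n; apply: climb_sure; exact: reachS ts.
  move=> h t a /(reachS s _ sS) tS Sa.
  by have [] := climb_actionsP tS Sa.
have stepE t a u : t \in reach s -> a \in sure_actions t -> 0 < trans t a u ->
    u \in reach s.
  move=> ts aA tu; rewrite -(reach_eq t ts) inE; apply: connect1.
  by rewrite /= (reachS s)//; apply/existsP; exists a; rewrite aA.
split=> //.
- by apply/set0Pn; exists s; rewrite inE connect0.
- by move=> t ts; apply: sure_actions_neq0; exact: reachS ts.
- by move=> t a _ /sure_actions_enabled.
- move=> t u ts us; have : u \in reach t by rewrite reach_eq.
  rewrite inE => /connectP[p]; elim: p t ts => [|v p IHp] t ts /=.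
    by move=> _ ->; rewrite connect0.
  move=> /andP[/andP[_ /existsP[a /andP[aA tv]]] vp] e.
  have vs := stepE _ _ _ ts aA tv.
  apply: connect_trans (IHp v vs vp e); apply: connect1.
  by rewrite /= ts; apply/existsP; exists a; rewrite aA.
Qed.

End sure_gain.

(** * The upper bound *)

Section safe_part.
Variables (R : realType) (M : mdp) (goal : state M).
Hypothesis hM : standing_assumptions goal.
Implicit Types (S : scheduler R M) (h : seq (letter M)) (s t u : state M).
Implicit Types (a : action M).

Local Notation W := (maxw M).
Local Notation reached := (at_goal goal (fun=> 1 : R)).

Let goal_abs := goal_absorbing hM.

(* The minimal probability of reaching [goal] within [k] steps. *)
Fixpoint minreach k s : R :=
  if s == goal then 1 else
  if k is k'.+1 then
    \big[Num.min/1]_(a | enabled s a) \sum_t tprob R s a t * minreach k' t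
  else 0.

Lemma minreach_goal k : minreach k goal = 1.
Proof. by case: k => [|k] /=; rewrite eqxx. Qed.

Lemma minreachS k s : s != goal -> minreach k.+1 s =
  \big[Num.min/1]_(a | enabled s a) \sum_t tprob R s a t * minreach k t.
Proof. by move=> /= /negPf ->. Qed.

Lemma minreach_ge0 k s : 0 <= minreach k s.
Proof.
elim: k s => [|k IHk] s; have [->|sg] := eqVneq s goal; rewrite ?minreach_goal//.
  by rewrite /= (negPf sg).
rewrite minreachS//; apply: le_bigmin => // a _; apply: sumr_ge0 => t _.
by rewrite mulr_ge0// tprob_ge0.
Qed.

Lemma minreach_action k s a : enabled s a ->
  minreach k.+1 s <= \sum_t tprob R s a t * minreach k t.
Proof.
move=> sa; have [sg|sg] := eqVneq s goal; last first.
  by rewrite minreachS//; exact: bigmin_le_cond.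
rewrite sg minreach_goal -(@tprob_sum R M s a sa) sg; apply: ler_sum => t _.
have := tprob_ge0 R goal a t; rewrite le_eqVlt => /predU1P[<-|].
  by rewrite mul0r.
rewrite tprob_gt0 => gt; have [-> _] := absorbing_step goal_abs gt.
by rewrite minreach_goal mulr1.
Qed.

Lemma minreach_mono k l s : (k <= l)%N -> minreach k s <= minreach l s.
Proof.
elim: k l s => [|k IHk] l s kl; have [->|sg] := eqVneq s goal;
  rewrite ?minreach_goal//.
  by rewrite [minreach 0 s]/= (negPf sg) minreach_ge0.
case: l kl => // l kl; rewrite [leRHS]minreachS//; apply: le_bigmin => [|a sa].
  by rewrite minreachS//; exact: bigmin_le_id.
by apply: le_trans (minreach_action k sa) _; apply: step_le => t _; exact: IHk.
Qed.

Lemma minreach_le S h s k : minreach k s <= pexp S h s k reached.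
Proof.
elim: k h s => [|k IHk] h s.
  by rewrite /= /at_goal mul1r; case: (s == goal).
rewrite pexpS -[leLHS](step_sum S h s); apply: ler_sum => a _.
have := choice_ge0 S h s a; rewrite le_eqVlt => /predU1P[<-|Sa].
  by rewrite !mul0r.
have sa := choice_enabled Sa; rewrite ler_pM2l// step_cst//.
by apply: le_trans (minreach_action k sa) _; apply: step_le.
Qed.

(** * Safe states and actions, at a horizon [K] that detects every inevitable risk of reaching
    [goal] *)

Section stable_horizon.
Variable K : nat.
Hypothesis stableK : forall s, minreach K s = 0 -> forall k, minreach k s = 0.

(** The minimal reaching probability after taking [a]; it vanishes exactly when all successors are
    safe. *)
Definition risk s a : R := \sum_t tprob R s a t * minreach K t.

Lemma risk_ge0 s a : 0 <= risk s a.
Proof. by apply: sumr_ge0 => t _; rewrite mulr_ge0 ?tprob_ge0 ?minreach_ge0. Qed.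

Lemma safe_state s a : enabled s a -> risk s a = 0 -> minreach K s = 0.
Proof.
move=> sa r0; apply/eqP; rewrite eq_le minreach_ge0 andbT -r0.
by apply: le_trans (minreach_mono _ (leqnSn K)) (minreach_action K sa).
Qed.

Lemma safe_successor s a t : risk s a = 0 -> 0 < trans s a t -> minreach K t = 0.
Proof.
move=> /eqP; rewrite psumr_eq0 => [/allP r0 st|u _]; last first.
  by rewrite mulr_ge0 ?tprob_ge0 ?minreach_ge0.
have := r0 t (mem_index_enum t).
by rewrite /= mulf_eq0 gt_eqF ?tprob_gt0//= => /eqP.
Qed.

(** If all enabled actions were risky, their finite minimum would be positive at horizon [K.+1],
    against stability. *)
Lemma safe_action s : minreach K s = 0 -> exists2 a, enabled s a & risk s a = 0.
Proof.
move=> s0; have sg : s != goal.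
  by apply/eqP => sg; move: s0; rewrite sg minreach_goal => /eqP; rewrite oner_eq0.
apply/not_exists2P => risky; have := stableK s0 K.+1; rewrite minreachS// => m0.
suff : 0 < \big[Num.min/1]_(a | enabled s a) risk s a by rewrite m0 ltxx.
apply: lt_bigmin => // a sa; rewrite lt_neqAle risk_ge0 andbT eq_sym.
by apply/eqP => r0; have [] := risky a.
Qed.

Definition safe_actions (h : seq (letter M)) s : {set action M} :=
  [set a | risk s a == 0]%SET.

Lemma uniform_safe h s a : minreach K s = 0 ->
  (0 < uniform R safe_actions h s a) = enabled s a && (risk s a == 0).
Proof.
move=> /safe_action[b sb rb]; rewrite uniform_gt0 effectiveE ?inE 1?andbC//.
by exists b; rewrite // inE rb.
Qed.

Lemma safe_avoids_goal : minreach K (s_init M) = 0 ->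
  Pr (uniform R safe_actions) (s_init M) (ev_reach goal) = 0%E.
Proof.
move=> s0; apply/eqP; rewrite eq_le measure_ge0 andbT.
apply: (cvge_le _ (@cvg_Pr_reach R M goal goal_abs _ _)); apply: nearW => n.
rewrite lee_fin -[leRHS](pexp_cst (uniform R safe_actions) [::] (s_init M) n).
apply: (@pexp_le_inv _ _ (fun _ s => minreach K s = 0)) => //.
  move=> h s a t sK; rewrite uniform_safe// => /andP[_ /eqP ra].
  exact: safe_successor ra.
move=> h s sK; rewrite /at_goal; case: eqP => [sg|_]; last by rewrite mulr0.
by move: sK; rewrite sg minreach_goal => /eqP; rewrite oner_eq0.
Qed.

Definition safe_path h s := [/\ is_path h s, first_state h s = s_init M &
  forall x, x \in h -> risk x.1 x.2 = 0].

(** The uniform choice among safe actions avoids [goal] and gives every step of a safe path positive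
    probability. *)
Lemma safe_cycle_critical h s : safe_path h s -> has_positive_cycle h s ->
  exists S, critical goal S.
Proof.
move=> [hp hi hr] hc; exists (uniform R safe_actions).
have en x : x \in h -> enabled x.1 x.2.
  move=> xh; case/splitPr: xh hp => h1 h2; rewrite is_path_cat => /andP[_].
  by case: x => y b /= /andP[/trans_enabled].
(* The cycle is nonempty, so [h] has a first action, whose zero risk makes the initial state
   safe. *)
have first0 : minreach K (s_init M) = 0.
  case: h hp hi hr hc en => [|[y b] h] hp hi hr hc en.
    by case: hc => h1 [c [h2 [/esym/eqP]]]; case: h1 => //; case: c.
  rewrite -hi; apply: (@safe_state y b); last exact: (hr (y, b) (mem_head _ _)).
  exact: (en (y, b) (mem_head _ _)).
split; first exact: safe_avoids_goal.
exists h, s; split=> //; split=> // h1 y b h2 e.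
have yb : (y, b) \in h by rewrite e mem_cat mem_head orbT.
rewrite uniform_safe; first by rewrite (en (y, b))//= (hr (y, b))// eqxx.
by apply: (@safe_state y b); [exact: (en (y, b))|exact: (hr (y, b))].
Qed.

Lemma first_state_drop h s i : (i < size h)%N ->
  first_state (drop i h) s = (nth (default_letter M) h i).1.
Proof. by move=> ih; rewrite (drop_nth (default_letter M) ih). Qed.

(** A path with more steps than there are states repeats a state; the cycle in between is not
    positive, so cutting it out does not lower the weight. *)
Lemma safe_path_wgt : ~ (exists S, critical goal S) ->
  forall h s, safe_path h s -> path_wgt h <= (W * #|state M|)%N%:Z.
Proof.
move=> nocrit h; have [n] := ubnP (size h); elim: n h => // n IHn h hn s sp.
have [hT|Th] := leqP (size h) #|state M|.
  by apply: le_trans (path_wgt_le h) _; rewrite lez_nat leq_mul2l hT orbT.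
have : ~~ uniq (unzip1 h).
  apply/negP => /card_uniqP hu; move: Th; rewrite ltnNge -(size_map fst h) -hu.
  by rewrite max_card.
move=> /(uniqPn (s_init M))[i [j [ij]]]; rewrite size_map => jh.
have ih := ltn_trans ij jh; rewrite !(nth_map (default_letter M))// => eij.
pose c := take (j - i) (drop i h).
have hE : h = take i h ++ c ++ drop j h.
  rewrite -[in LHS](cat_take_drop i h) -[in LHS](cat_take_drop (j - i) (drop i h)).
  by rewrite drop_drop subnK// ltnW.
have cyc : first_state (c ++ drop j h) s = first_state (drop j h) s.
  rewrite /c -[drop j h in LHS](_ : drop (j - i) (drop i h) = _).
    by rewrite cat_take_drop !first_state_drop.
  by rewrite drop_drop subnK// ltnW.
have [hp hi hr] := sp.
have c0 : path_wgt c <= 0.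
  rewrite leNgt; apply/negP => cw; apply: nocrit.
  apply: (safe_cycle_critical sp); exists (take i h), c, (drop j h); split=> //.
  have : (0 < size c)%N by rewrite size_takel ?subn_gt0// size_drop leq_sub2r// ltnW.
  by case: c {cw cyc hE}.
have -> : path_wgt h = path_wgt (take i h ++ drop j h) + path_wgt c.
  by rewrite [in LHS]hE !path_wgt_cat addrA addrAC.
have sz : (size (take i h ++ drop j h) < n)%N.
  rewrite size_cat size_takel ?(ltnW ih)// size_drop.
  by move: (size h) ij jh hn => m; lia.
apply: (@le_trans _ _ (path_wgt (take i h ++ drop j h))); first by lia.
apply: (IHn _ sz s); split.
- move: hp; rewrite [in X in X -> _]hE !is_path_cat first_state_cat.
  move=> /and3P[ip _ jp]; rewrite jp andbT.
  by move: ip; rewrite -first_state_cat cyc.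
- by move: hi; rewrite [in X in X -> _]hE first_state_cat cyc -first_state_cat.
- move=> x; rewrite mem_cat => /orP[/mem_take|/mem_drop]; exact: hr.
Qed.

(** * Charging the positive weight at [goal] to the probability of reaching it *)

Section bounded_expectation.
Variables (L C d : R).
Hypotheses (L0 : 0 <= L) (C0 : 0 <= C) (d0 : 0 < d).
Hypothesis safe_wgt : forall h s, safe_path h s -> (path_wgt h)%:~R <= L.
Hypothesis gain_le : forall S h s k,
  pexp S h s k (fun h' _ => posw R (path_wgt h' - path_wgt h)) <= C.
Hypothesis risk_d : forall s a, 0 < risk s a -> d <= risk s a.

(** The first term pays for a safe path already ending in [goal]; the second, multiplied by [d],
    pays for everything from a risky action on. *)
Let c := L + (L + W%:R + C) / d.

(* Until the first risky action the weight is at most [L]; from then on it grows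
   in expectation by at most [W + C] while [goal] is reached with probability at
   least [d]. *)
Lemma pexp_posw_reached n S h s : safe_path h s ->
  pexp S h s n (at_goal goal (posw R)) <= c * pexp S h s (n + K) reached.
Proof.
have LWC : 0 <= (L + W%:R + C) / d by rewrite divr_ge0 ?addr_ge0// ltW.
have c0 : 0 <= c by rewrite addr_ge0.
elim: n h s => [|n IHn] h s sp.
  rewrite add0n [leLHS]/= {1}/at_goal; have [->|_] := eqVneq s goal; last first.
    by rewrite mulr0 mulr_ge0// pexp_reached_ge0.
  rewrite (pexp_goal_absorbed goal_abs) !mulr1 /posw ge_max c0 andbT.
  by apply: le_trans (safe_wgt sp) _; rewrite lerDl.
rewrite addSn !pexpS mulr_sumr; apply: ler_sum => a _.
rewrite mulrCA; have := choice_ge0 S h s a.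
rewrite le_eqVlt => /predU1P[<-|Sa]; first by rewrite !mul0r.
have sa := choice_enabled Sa; rewrite ler_pM2l//.
have := risk_ge0 s a; rewrite le_eqVlt => /predU1P[/esym r0|/risk_d rd].
  rewrite mulr_sumr; apply: ler_sum => t _; rewrite mulrCA.
  have := tprob_ge0 R s a t; rewrite le_eqVlt => /predU1P[<-|].
    by rewrite !mul0r.
  move=> T0; rewrite ler_pM2l//; move: T0; rewrite tprob_gt0 => st; apply: IHn.
  have [hp hi hr] := sp; split.
  - by rewrite -cats1 is_path_cat /= hp st.
  - by rewrite first_state_rcons.
  - by move=> x; rewrite mem_rcons inE => /predU1P[->//|]; exact: hr.
apply: (@le_trans _ _ (L + W%:R + C)).
  rewrite -[leRHS](step_cst _ sa); apply: step_le => t _.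
  apply: (@le_trans _ _ (pexp S (rcons h (s, a)) t n (fun h' _ =>
      L + W%:R + posw R (path_wgt h' - path_wgt (rcons h (s, a)))))).
    apply: pexp_le => h' u; rewrite /at_goal.
    apply: (@le_trans _ _ (posw R (path_wgt h'))).
      by rewrite -[leRHS]mulr1 ler_wpM2l ?posw_ge0//; case: (u == goal).
    set D := _ - _; have -> : path_wgt h' = path_wgt h + wgt s a + D.
      by rewrite /D path_wgt_rcons /=; lia.
    move: D => D.
    have hL := safe_wgt sp; have aW := norm_wgt_le R s a.
    have W0 : 0 <= W%:R :> R by [].
    have wn := ler_norm ((wgt s a)%:~R : R).
    have D1 : D%:~R <= posw R D by rewrite le_max lexx.
    rewrite [leLHS]/posw ge_max !rmorphD /=; apply/andP; split.
      by rewrite !lerD// (le_trans wn).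
    by rewrite !addr_ge0// posw_ge0.
  by rewrite pexpD pexp_cst lerD2l.
apply: (@le_trans _ _ (c * d)).
  by rewrite mulrDl divfK ?gt_eqF// lerDr mulr_ge0// ltW.
rewrite ler_wpM2l//; apply: le_trans rd _; apply: step_le => t _.
apply: le_trans (minreach_le S (rcons h (s, a)) t K) _.
by apply: pexp_at_goal_mono; [|move=> *; exact: ler01|exact: leq_addl].
Qed.

End bounded_expectation.

End stable_horizon.

(** Minimal reaching probabilities grow with the horizon, and there are finitely many states to wait
    for. *)
Lemma stable_horizon_ex : exists K, forall s, minreach K s = 0 ->
  forall k, minreach k s = 0.
Proof.
pose P s n := (exists k, 0 < minreach k s) -> 0 < minreach n s.
have [K KP] : exists K, forall s, P s K.
  apply: fin_uniform_nat => [s m n mn sm /sm|s].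
    by move=> /lt_le_trans; apply; exact: minreach_mono.
  have [[k sk]|nk] := pselect (exists k, 0 < minreach k s).
    by exists k.
  by exists 0%N => /nk.
exists K => s sK k; apply/eqP; rewrite eq_le minreach_ge0 andbT leNgt.
by apply/negP => sk; have := KP s (ex_intro _ k sk); rewrite sK ltxx.
Qed.

Lemma CE_bounded :
  ~ (exists (E : {set state M}) (A : state M -> {set action M}),
       end_component E A /\ pos_wgt_divergent R E A) ->
  ~ (exists S : scheduler R M, critical goal S) ->
  exists c : R, forall S, (0 < Pr S (s_init M) (ev_reach goal))%E ->
    (CE S goal <= c%:E)%E.
Proof.
move=> noEC nocrit.
have [K stableK] := stable_horizon_ex.
have [d d0 dP] : exists2 d : R, 0 < d & forall x : state M * action M,
    0 < risk K x.1 x.2 -> d <= risk K x.1 x.2.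
  apply: fin_uniform_real => [x p q _ pq xq /xq|x]; first exact: le_trans.
  have [r0|r0] := boolP (0 < risk K x.1 x.2); first by exists (risk K x.1 x.2).
  by exists 1 => // /(negP r0).
have [C C0 CP] : exists2 C : R, 0 <= C & forall S h s k,
    pexp S h s k (fun h' _ => posw R (path_wgt h' - path_wgt h)) <= C.
  have [L [q q0 qP]] := unsure_uniform R M.
  (* The successor makes the level positive, as the geometric bound requires. *)
  exists ((L.+1 + W)%:R / q); first by rewrite divr_ge0// ltW.
  apply: pexp_posw_bounded => // k s; apply: qP; last by rewrite lez_nat.
  apply/negP => sS; apply: noEC; apply: sure_divergent_component.
  by apply/set0Pn; exists s; exact: sS.
pose L : R := (W * #|state M|)%:R.
exists (L + (L + W%:R + C) / d) => S P0.
apply: (@CE_le R M goal goal_abs S _ K P0) => n.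
apply: pexp_posw_reached => //.
- move=> h s sp.
  change ((path_wgt h)%:~R <= ((W * #|state M|)%N%:Z)%:~R :> R).
  by rewrite ler_int; apply: safe_path_wgt sp.
- by move=> s a; exact: (dP (s, a)).
Qed.

End safe_part.

Theorem proposition7 (R : realType) (M : mdp) (goal : state M)
    (hM : standing_assumptions goal) :
  CE_sup R goal \is a fin_num <->
  ~ (exists (E : {set state M}) (A : state M -> {set action M}),
       end_component E A /\ pos_wgt_divergent R E A) /\
  ~ (exists S : scheduler R M, critical goal S).
Proof.
split=> [CEfin|[noEC nocrit]].
  split=> [[E [A [EA EAdiv]]]|[S Scrit]]; apply: (gains_unbounded hM _ CEfin).
    exact: divergent_gains EA EAdiv.
  exact: critical_gains Scrit.
have [c cP] := CE_bounded hM noEC nocrit.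
(* Finiteness also needs a lower bound: exploration from the initial state reaches [goal] and
   provides one. *)
have [N NP] := explore_gains R hM.
have NCE := gains_CE hM (NP _ (all_reachable hM goal)).
rewrite fin_numElt (lt_le_trans (ltNyr N) NCE)/=.
apply: le_lt_trans (ltry c); apply: ge_ereal_sup => _ [S SP <-].
exact: cP.
Qed.
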